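(* Let $(M,g)$ be a Riemannian manifold of dimension $m$, let $\pi:E\to M$ be a vector bundle of rank $k\ge 1$ with fiber metric $h$ and compatible connection $D$, and let $G$ be the spherically symmetric metric on the total space $E$ with weight functions $\varphi_1,\varphi_2$. For every smooth function $f:M\to\mathbb{R}$, with vertical lift $f^v=f\circ\pi$, one has $$\Delta_G^2(f^v)=e^{-4\varphi_1}(\Delta_g^2 f)^v-4e^{-2(\varphi_1+\varphi_2)}\Big(2r\varphi_1''-4r\varphi_1'(\varphi_1+\varphi_2)'+2mr(\varphi_1')^2+2kr\varphi_1'\varphi_2'+k\varphi_1'\Big)(\Delta_g f)^v ,$$ where $\varphi_1,\varphi_2$ and their derivatives are evaluated at $r=h(e,e)$, $e\in E$.
   Context: All manifolds and geometric objects are smooth ($C^\infty$); manifolds are connected and without boundary. $(E,\pi,M)$ is a real vector bundle of rank $k$ over the Riemannian manifold $(M,g)$ of dimension $m$, with a (Riemannian) fiber metric $h$ and a connection $D$ with $Dh=0$. Let $K$ be the connection map of $D$; it yields the splitting $TE=\mathcal H\oplus\mathcal V$ into horizontal ($\ker K$) and vertical ($\ker d\pi$) subbundles. A spherically symmetric metric on $E$ is a Riemannian metric of the form $$G_e(X,Y)=e^{2\varphi_1}g(d\pi(X),d\pi(Y))+e^{2\varphi_2}h(K_e(X),K_e(Y)),\qquad X,Y\in T_eE,$$ where the weight functions $\varphi_1,\varphi_2$ are real functions of $r=h(e,e)$, which together with all their successive derivatives are smooth on $(0,+\infty)$ and at $r=0$ on the right; primes denote derivatives with respect to $r$. For a function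 $u$ on $M$, $u^v=u\circ\pi$ is its vertical lift. $\Delta_g,\Delta_G$ are the Laplace–Beltrami operators ($\Delta=\operatorname{div}\operatorname{grad}$) of $(M,g)$ and $(E,G)$; $\Delta^2$ denotes $\Delta\circ\Delta$. *)

(* Defs.v *)
From HB Require Import structures.
From mathcomp Require Import all_boot all_order all_algebra.
From mathcomp Require Import all_classical all_reals all_analysis.
Set Implicit Arguments.
Unset Strict Implicit.
Unset Printing Implicit Defensive.
Import Order.TTheory GRing.Theory Num.Theory numFieldNormedType.Exports.
Local Open Scope classical_set_scope.
Local Open Scope ring_scope.

(* C^k regularity, meaningful for open U only. *)
Fixpoint Cn {R : realType} {n : nat} {W : normedModType R} (k : nat)
    (U : set 'rV[R]_n) (f : 'rV[R]_n -> W) : Prop :=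
  match k with
  | 0 => forall x, U x -> {for x, continuous f}
  | k'.+1 => (forall x, U x -> differentiable f x) /\
             forall v : 'rV[R]_n, Cn k' U (fun x => 'D_v f x)
  end.

Definition smooth_on {R : realType} {n : nat} {W : normedModType R}
    (U : set 'rV[R]_n) (f : 'rV[R]_n -> W) : Prop :=
  forall k, Cn k U f.

(* Derivative relative to [0, +oo): two-sided at r > 0, right derivative at
   r = 0. *)
Definition quot_Rplus {R : realType} (phi : R -> R) (r : R) : R -> R :=
  fun t => (phi t - phi r) / (t - r).

Definition filter_Rplus {R : realType} (r : R) : set_system R :=
  within [set t : R | 0 <= t] r^'.

Definition deriv_Rplus {R : realType} (phi : R -> R) (r : R) : R :=
  lim (quot_Rplus phi r t @[t --> filter_Rplus r]).

Definition smooth_Rplus {R : realType} (phi : R -> R) : Prop :=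
  forall (k : nat) (r : R), 0 <= r ->
    cvg (quot_Rplus (iter k deriv_Rplus phi) r t @[t --> filter_Rplus r]).

(* [cmap] is only meaningful on [cdom], and [cinv] on [cimg]. *)
Record chart (R : realType) (n : nat) (T : Type) := Chart {
  cdom : set T;
  cmap : T -> 'rV[R]_n;
  cinv : 'rV[R]_n -> T
}.

Definition cimg {R : realType} {n : nat} {T : Type} (c : chart R n T) :
  set 'rV[R]_n := cmap c @` cdom c.

Record is_chart {R : realType} {n : nat} {T : topologicalType}
    (c : chart R n T) : Prop := IsChart {
  cdom_open : open (cdom c);
  cimg_open : open (cimg c);
  cmapK : forall p, cdom c p -> cinv c (cmap c p) = p;
  cmap_cont : forall p, cdom c p -> {for p, continuous (cmap c)};
  cinv_cont : forall x, cimg c x -> {for x, continuous (cinv c)}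
}.

Definition smooth_transition {R : realType} {n : nat} {T : Type}
    (c c' : chart R n T) : Prop :=
  smooth_on (cmap c @` (cdom c `&` cdom c')) (cmap c' \o cinv c).

Record manifold (R : realType) (n : nat) := Manifold {
  carrier :> topologicalType;
  mf_hausdorff : hausdorff_space carrier;
  mf_second_countable : @second_countable carrier;
  mf_connected : connected [set: carrier];
  atlas : set (chart R n carrier);
  atlas_chart : forall c, atlas c -> is_chart c;
  atlas_cover : forall p : carrier, exists c, atlas c /\ cdom c p;
  atlas_smooth : forall c c', atlas c -> atlas c' -> smooth_transition c c';
  atlas_max : forall c, is_chart c ->
    (forall c', atlas c' -> smooth_transition c c' /\ smooth_transition c' c) ->
    atlas c
}.
Arguments atlas {R n} M _ : rename.

Definition smooth_fun {R : realType} {n : nat} {W : normedModType R}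
    (M : manifold R n) (A : set M) (u : M -> W) : Prop :=
  forall c, atlas M c -> smooth_on (cmap c @` (A `&` cdom c)) (u \o cinv c).

Definition smooth_map {R : realType} {n k : nat}
    (M : manifold R n) (N : manifold R k) (A : set M) (F : M -> N) : Prop :=
  (forall p, A p -> {for p, continuous F}) /\
  forall c c', atlas M c -> atlas N c' ->
    smooth_on (cmap c @` (A `&` cdom c `&` F @^-1` cdom c'))
              (cmap c' \o F \o cinv c).

(* The tangent space at p is identified with R^n by means of one fixed chart
   [chart_at p] around p; [tcomp] and [coord_vec] pass between this
   identification and the components in an arbitrary chart. *)
Definition chart_at {R : realType} {n : nat} {M : manifold R n} (p : M) :
  chart R n M := projT1 (cid (atlas_cover p)).

Definition tangent {R : realType} {n : nat} {M : manifold R n} (p : M) :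
  normedModType R := 'rV[R]_n.

Definition tcomp {R : realType} {n : nat} {M : manifold R n}
    (c : chart R n M) (p : M) (X : tangent p) : 'rV[R]_n :=
  'd (cmap c \o cinv (chart_at p)) (cmap (chart_at p) p) X.

Definition coord_vec {R : realType} {n : nat} {M : manifold R n}
    (c : chart R n M) (p : M) (i : 'I_n) : tangent p :=
  'd (cmap (chart_at p) \o cinv c) (cmap c p) (delta_mx 0 i).

Definition dfun {R : realType} {n : nat} {M : manifold R n}
    (u : M -> R) (p : M) (X : tangent p) : R :=
  'd (u \o cinv (chart_at p)) (cmap (chart_at p) p) X.

Definition dmap {R : realType} {n k : nat} {M : manifold R n}
    {N : manifold R k} (F : M -> N) (p : M) (X : tangent p) : tangent (F p) :=
  'd (cmap (chart_at (F p)) \o F \o cinv (chart_at p))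
     (cmap (chart_at p) p) X.

Definition smooth_vf {R : realType} {n : nat} {M : manifold R n}
    (A : set M) (X : forall p : M, tangent p) : Prop :=
  forall c, atlas M c -> smooth_fun (A `&` cdom c) (fun p => tcomp c (X p)).

Record riemannian_metric (R : realType) (n : nat) (M : manifold R n) :=
  RiemannianMetric {
  metric :> forall p : M, tangent p -> tangent p -> R;
  metric_linear : forall (p : M) (Y : tangent p),
    scalar (fun X : tangent p => metric X Y);
  metric_sym : forall (p : M) (X Y : tangent p), metric X Y = metric Y X;
  metric_pos : forall (p : M) (X : tangent p), X != 0 -> 0 < metric X X;
  metric_smooth : forall (c : chart R n M) (i j : 'I_n), atlas M c ->
    smooth_fun (cdom c)
      (fun p => metric (coord_vec c p i) (coord_vec c p j))
}.

Definition gram {R : realType} {n : nat} {M : manifold R n}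
    (g : riemannian_metric M) (c : chart R n M) (x : 'rV[R]_n) : 'M[R]_n :=
  \matrix_(i, j) g (cinv c x) (coord_vec c (cinv c x) i)
                              (coord_vec c (cinv c x) j).

Definition partial {R : realType} {n : nat} (i : 'I_n) (f : 'rV[R]_n -> R)
    (x : 'rV[R]_n) : R := 'D_(delta_mx 0 i) f x.

(* Christoffel symbol Gamma^i_{jl} of the Levi-Civita connection of g. *)
Definition christoffel {R : realType} {n : nat} {M : manifold R n}
    (g : riemannian_metric M) (c : chart R n M) (i j l : 'I_n)
    (x : 'rV[R]_n) : R :=
  2^-1 * \sum_(s < n) invmx (gram g c x) i s *
    (partial j (fun y => gram g c y s l) x +
     partial l (fun y => gram g c y s j) x -
     partial s (fun y => gram g c y j l) x).

Definition gradient {R : realType} {n : nat} {M : manifold R n}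
    (g : riemannian_metric M) (u : M -> R) (p : M) : tangent p :=
  xget 0 [set Y : tangent p | forall Z : tangent p, g p Y Z = dfun u Z].

(* Trace of the covariant derivative, in the chart at p:
   sum_i (d_i X^i + sum_j Gamma^i_{ij} X^j). *)
Definition divergence {R : realType} {n : nat} {M : manifold R n}
    (g : riemannian_metric M) (X : forall p : M, tangent p) (p : M) : R :=
  let c := chart_at p in
  let Xc := fun x : 'rV[R]_n => tcomp c (X (cinv c x)) in
  let x := cmap c p in
  \sum_(i < n) (partial i (fun y => Xc y 0 i) x +
                \sum_(j < n) christoffel g c i i j x * Xc x 0 j).

Definition laplacian {R : realType} {n : nat} {M : manifold R n}
    (g : riemannian_metric M) (u : M -> R) : M -> R :=
  divergence g (gradient g u).

(* [pt v] is the point of the total space defined by the vector v of the fibre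
   over p. The chart of E induced by a chart c of M and a local trivialization
   e |-> (bproj e, tr e) whose inverse is (p, y) |-> pt (trinv p y). *)
Definition bundle_chart {R : realType} {m k : nat} {M : Type} {T : Type}
    {fib : M -> lmodType R} (bproj : T -> M) (pt : forall p : M, fib p -> T)
    (c : chart R m M) (tr : T -> 'rV[R]_k)
    (trinv : forall p : M, 'rV[R]_k -> fib p) : chart R (m + k) T :=
  Chart (bproj @^-1` cdom c)
        (fun e => row_mx (cmap c (bproj e)) (tr e))
        (fun z => pt (cinv c (lsubmx z)) (trinv _ (rsubmx z))).

(* The charts of E induced by a local trivialization are charts of the manifold
   E; this says that the trivialization is a diffeomorphism from bproj^-1(U) onto
   U x R^k (and forces bproj to be a smooth map). *)
Record vector_bundle (R : realType) (m k : nat) (M : manifold R m) :=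
  VectorBundle {
  fib : M -> lmodType R;
  total_space : manifold R (m + k);
  bproj : total_space -> M;
  pt : forall p : M, fib p -> total_space;
  bproj_pt : forall (p : M) (v : fib p), bproj (pt v) = p;
  pt_inj : forall p : M, injective (@pt p);
  pt_surj : forall e : total_space, exists v : fib (bproj e), pt v = e;
  loc_triv : forall p : M,
    exists (U : set M) (tr : total_space -> 'rV[R]_k)
           (trinv : forall q : M, 'rV[R]_k -> fib q),
    [/\ open_nbhs p U,
        forall q, U q -> [/\ linear (fun v : fib q => tr (pt v)),
                             cancel (fun v : fib q => tr (pt v)) (trinv q) &
                             cancel (trinv q) (fun v : fib q => tr (pt v))] &
        forall c, atlas M c -> cdom c `<=` U ->
          atlas total_space (bundle_chart bproj pt c tr trinv)]
}.
Arguments pt {R m k M} E {p} v : rename.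
Arguments bproj {R m k M} E e : rename.
Arguments fib {R m k M} E p : rename.

Definition section {R : realType} {m k : nat} {M : manifold R m}
    (E : vector_bundle k M) : Type := forall p : M, fib E p.

Definition smooth_section {R : realType} {m k : nat} {M : manifold R m}
    {E : vector_bundle k M} (A : set M) (s : section E) : Prop :=
  smooth_map A (fun p => pt E (s p)).

(* Only the restriction of s to some neighbourhood of p matters. *)
Definition smooth_section_near {R : realType} {m k : nat} {M : manifold R m}
    {E : vector_bundle k M} (p : M) (s : section E) : Prop :=
  exists2 A, open_nbhs p A & smooth_section A s.

Definition smooth_fun_near {R : realType} {m : nat} {M : manifold R m}
    (p : M) (u : M -> R) : Prop :=
  exists2 A, open_nbhs p A & smooth_fun A u.

Record fiber_metric (R : realType) (m k : nat) (M : manifold R m)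
    (E : vector_bundle k M) := FiberMetric {
  fmetric :> forall p : M, fib E p -> fib E p -> R;
  fmetric_linear : forall (p : M) (w : fib E p),
    scalar (fun v : fib E p => fmetric v w);
  fmetric_sym : forall (p : M) (v w : fib E p), fmetric v w = fmetric w v;
  fmetric_pos : forall (p : M) (v : fib E p), v != 0 -> 0 < fmetric v v;
  fmetric_smooth : forall (A : set M) (s t : section E), open A ->
    smooth_section A s -> smooth_section A t ->
    smooth_fun A (fun p => fmetric (s p) (t p))
}.
Arguments fmetric {R m k M E} h {p} v w : rename.

(* A connection as the covariant derivative D_X s at p of a local section s near
   p along X in T_pM. Its values on sections that are not smooth near p are
   irrelevant. The Leibniz rule, applied to functions that are smooth near p
   only, makes D_X s depend on the germ of s at p only. *)
Record connection (R : realType) (m k : nat) (M : manifold R m)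
    (E : vector_bundle k M) := Connection {
  cov :> forall p : M, tangent p -> section E -> fib E p;
  cov_linear : forall (p : M) (s : section E), smooth_section_near p s ->
    linear (fun X : tangent p => cov X s);
  cov_add : forall (p : M) (X : tangent p) (s t : section E),
    smooth_section_near p s -> smooth_section_near p t ->
    cov X (fun q => s q + t q) = cov X s + cov X t;
  cov_leibniz : forall (p : M) (X : tangent p) (u : M -> R) (s : section E),
    smooth_fun_near p u -> smooth_section_near p s ->
    cov X (fun q => u q *: s q) = dfun u X *: s p + u p *: cov X s;
  cov_smooth : forall (A : set M) (X : forall p : M, tangent p)
      (s : section E), open A -> smooth_vf A X -> smooth_section A s ->
    smooth_section A (fun p => cov (X p) s)
}.
Arguments cov {R m k M E} D {p} X s : rename.

Definition compatible {R : realType} {m k : nat} {M : manifold R m}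
    {E : vector_bundle k M} (D : connection E) (h : fiber_metric E) : Prop :=
  forall (p : M) (X : tangent p) (s t : section E),
    smooth_section_near p s -> smooth_section_near p t ->
    dfun (fun q => fmetric h (s q) (t q)) X =
    fmetric h (cov D X s) (t p) + fmetric h (s p) (cov D X t).

(* The vertical vector at v defined by w: velocity at 0 of t |-> v + t w. *)
Definition vertical {R : realType} {m k : nat} {M : manifold R m}
    {E : vector_bundle k M} (p : M) (v w : fib E p) : tangent (pt E v) :=
  derive1 (fun t : R => cmap (chart_at (pt E v)) (pt E (v + t *: w))) 0.

(* These properties determine K: the tangent space of E at [pt v] is the direct
   sum of the vertical space and of the image of ds_p, for any local section s
   with s p = v. *)
Record connection_map {R : realType} {m k : nat} {M : manifold R m}
    {E : vector_bundle k M} (D : connection E) := ConnectionMap {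
  conn_map :> forall (p : M) (v : fib E p), tangent (pt E v) -> fib E p;
  conn_map_linear : forall (p : M) (v : fib E p), linear (@conn_map p v);
  conn_map_vertical : forall (p : M) (v w : fib E p),
    conn_map (vertical v w) = w;
  conn_map_section : forall (p : M) (X : tangent p) (s : section E),
    smooth_section_near p s ->
    @conn_map p (s p) (dmap (fun q => pt E (s q)) X) = cov D X s
}.
Arguments conn_map {R m k M E D} K {p v} X : rename.

Definition spherically_symmetric {R : realType} {m k : nat} {M : manifold R m}
    {E : vector_bundle k M} (g : riemannian_metric M) (h : fiber_metric E)
    (D : connection E) (K : connection_map D) (phi1 phi2 : R -> R)
    (G : riemannian_metric (total_space E)) : Prop :=
  forall (p : M) (v : fib E p) (X Y : tangent (pt E v)),
    let r := fmetric h v v in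
    G (pt E v) X Y =
      expR (2 * phi1 r) *
        g (bproj E (pt E v)) (dmap (bproj E) X) (dmap (bproj E) Y) +
      expR (2 * phi2 r) * fmetric h (conn_map K X) (conn_map K Y).

(* Main.v *)
Require Import Defs.
From mathcomp Require Import all_boot all_order all_algebra.
From mathcomp Require Import all_classical all_reals all_analysis.
From mathcomp Require Import ring.
Set Implicit Arguments.
Unset Strict Implicit.
Unset Printing Implicit Defensive.
Import Order.TTheory GRing.Theory Num.Theory numFieldNormedType.Exports.
Local Open Scope classical_set_scope.
Local Open Scope ring_scope.

(** The Laplacian is local, so it can be computed in a chart (x, y) of E that
    comes from a chart of M and a local trivialization of E. There the Gram
    matrix of G is P B P^T, where B is block diagonal with blocks
    exp(2 phi1) g and exp(2 phi2) h, and where P is a unipotent shear made of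
    the connection coefficients ([gram_total]).

    The divergence of a vector field X for a metric with Gram matrix G is
    tr (DX) + 1/2 tr (G^-1 D_X G), called [ldiv] below. The second term is the
    derivative of log sqrt (det G), hence the shear does not contribute to it:
    it is the same expression for g, plus the one for h, plus
    (m phi1' + k phi2') X(r), with r = h(e, e) ([mxtrace_dlog]).

    Since D h = 0, horizontal vectors annihilate r ([D_rad_horizontal]), and the
    divergence of the horizontal lift of a field Z of M is the divergence of Z
    ([ldiv_horizontal]). For a function u of M, the gradient of its lift is
    exp(-2 phi1) times the horizontal lift of grad u ([drow_base]), so that
    Delta_G (u^v) = exp(-2 phi1) (Delta_g u)^v ([laplacian_lift_frame]).

    This is applied once to f. For the second Laplacian, u = Delta_g f and the
    gradient of exp(-2 phi1) u^v is the sum of exp(-4 phi1) times the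
    horizontal lift of grad u and of u psi xi, where xi is the position field
    of the fibres and psi = -4 phi1' exp(-2 (phi1 + phi2))
    ([drow_weighted_lift]). From div xi = k + 2 r (m phi1' + k phi2')
    ([ldiv_vertical]), xi(r) = 2 r and xi(u^v) = 0, the product rule gives
    div (u psi xi) = u (psi (k + 2 r (m phi1' + k phi2')) + 2 r psi'), which is
    the second term of the formula.

    Two points need care. The divergence at a point is defined with one chosen
    chart; that every chart yields the same value is [divergence_chart], a
    consequence of the change of variables [ldiv_change] and of the symmetry of
    second derivatives. It is used on E, to pass to bundle charts, and on M, to
    see that Delta_g f is again smooth ([laplacian_smooth]). The weights are
    differentiable only relative to [0, +oo), while the chain rule for
    phi1(h(e, e)) is needed on the zero section as well; prolonging the weights
    by their tangent line at 0 settles this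
    ([is_derive_half_line_extension]). *)

(** * Calculus of matrix-valued maps *)

Section Calculus.
Context {R : realType} {V : normedModType R}.

Lemma near_eq_differentiable {W : normedModType R} (f g : V -> W) (x : V) :
  {near x, f =1 g} -> differentiable f x -> differentiable g x.
Proof.
move=> fg df; apply/diff_locallyP.
have [dfc /eqaddoP fx] := (diff_locallyP _ _).1 df.
have gx : g \o shift x = cst (g x) + 'd f x +o_ 0 id.
  apply/eqaddoP => e /fx.
  have : \forall h \near (0 : V), f (h + x) = g (h + x).
    by move: fg; rewrite (near_shift 0)/= subr0.
  apply: filterS2 => h /= fgh.
  by rewrite !fctE -fgh -(nbhs_singleton fg).
have dE : 'd g x = 'd f x :> (V -> W) by exact: diff_unique.
by rewrite dE.
Qed.

Lemma differentiable_mxP {p q : nat} (A : V -> 'M[R]_(p, q)) (x : V) :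
  differentiable A x <-> forall i j, differentiable (fun y => A y i j) x.
Proof.
split=> [dA i j|dA].
  apply: (@differentiable_comp _ _ _ _ A (fun N => N i j)) => //.
  exact: differentiable_coord.
have -> : A = \sum_(i < p) \sum_(j < q) (fun y => A y i j *: delta_mx i j).
  apply/funext => y; rewrite fct_sumE [LHS]matrix_sum_delta.
  by apply: eq_bigr => i _; rewrite fct_sumE.
apply: differentiable_sum => i; apply: differentiable_sum => j.
by apply: differentiableZl; exact: dA.
Qed.

Lemma derive_mxE {p q : nat} (A : V -> 'M[R]_(p, q)) (x v : V) i j :
  differentiable A x -> ('D_v A x) i j = 'D_v (fun y => A y i j) x.
Proof.
by move=> dA; rewrite derive_mx ?mxE//; exact: diff_derivable.
Qed.

Lemma differentiable_bigsum {W : normedModType R} (I : Type) (r : seq I) (P : pred I)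
    (f : I -> V -> W) (x : V) :
  (forall i, P i -> differentiable (f i) x) ->
  differentiable (fun y => \sum_(i <- r | P i) f i y) x.
Proof.
move=> df; rewrite (_ : (fun y => _) = \sum_(i <- r | P i) f i); last first.
  by apply/funext => y; rewrite fct_sumE.
elim/big_ind: _ => [|? ?|i /df//]; last exact: differentiableD.
exact: (differentiable_cst (0 : W)).
Qed.

Lemma derive_bigsum {W : normedModType R} (I : Type) (r : seq I)
    (f : I -> V -> W) (x v : V) :
  (forall i, differentiable (f i) x) ->
  'D_v (fun y => \sum_(i <- r) f i y) x = \sum_(i <- r) 'D_v (f i) x.
Proof.
move=> df; elim: r => [|i r IH].
  under eq_fun do rewrite big_nil.
  by rewrite big_nil derive_cst.
under eq_fun do rewrite big_cons.
rewrite big_cons -IH (_ : (fun y => _) = f i + (fun y => \sum_(j <- r) f j y))//.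
by rewrite deriveD//; apply: diff_derivable => //; exact: differentiable_bigsum.
Qed.

Lemma differentiable_mul (f g : V -> R) (x : V) :
  differentiable f x -> differentiable g x ->
  differentiable (fun y => f y * g y) x.
Proof. exact: differentiableM. Qed.

Lemma differentiable_add {W : normedModType R} (f g : V -> W) (x : V) :
  differentiable f x -> differentiable g x ->
  differentiable (fun y => f y + g y) x.
Proof. exact: differentiableD. Qed.

Lemma differentiable_mulmx {p q s : nat} (A : V -> 'M[R]_(p, q))
    (B : V -> 'M[R]_(q, s)) (x : V) :
  differentiable A x -> differentiable B x ->
  differentiable (fun y => A y *m B y) x.
Proof.
move=> /differentiable_mxP dA /differentiable_mxP dB.
apply/differentiable_mxP => i j.
under eq_fun do rewrite mxE.
apply: differentiable_bigsum => l _.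
exact: differentiable_mul.
Qed.

Lemma derive_mulmx {p q s : nat} (A : V -> 'M[R]_(p, q))
    (B : V -> 'M[R]_(q, s)) (x v : V) :
  differentiable A x -> differentiable B x ->
  'D_v (fun y => A y *m B y) x = 'D_v A x *m B x + A x *m 'D_v B x.
Proof.
move=> dA dB; apply/matrixP => i j.
rewrite derive_mxE; last exact: differentiable_mulmx.
have dA' := (differentiable_mxP A x).1 dA.
have dB' := (differentiable_mxP B x).1 dB.
under eq_fun do rewrite mxE.
rewrite derive_bigsum => [|l]; last first.
  exact: differentiable_mul.
rewrite !mxE -big_split/=; apply: eq_bigr => l _.
rewrite (@deriveM _ _ (fun y => A y i l) (fun y => B y l j));
  try exact: diff_derivable.
rewrite !derive_mxE//= addrC; congr (_ + _); by rewrite mulrC.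
Qed.

Lemma differentiable_trmx {p q : nat} (A : V -> 'M[R]_(p, q)) (x : V) :
  differentiable A x -> differentiable (fun y => (A y)^T) x.
Proof.
move=> /differentiable_mxP dA; apply/differentiable_mxP => i j.
by under eq_fun do rewrite mxE.
Qed.

Lemma derive_trmx {p q : nat} (A : V -> 'M[R]_(p, q)) (x v : V) :
  differentiable A x -> 'D_v (fun y => (A y)^T) x = ('D_v A x)^T.
Proof.
move=> dA; apply/matrixP => i j.
rewrite mxE !derive_mxE//; last exact: differentiable_trmx.
by under eq_fun do rewrite mxE.
Qed.

Lemma differentiable_scalemx {p q : nat} (a : V -> R) (A : V -> 'M[R]_(p, q)) x :
  differentiable a x -> differentiable A x ->
  differentiable (fun y => a y *: A y) x.
Proof.
move=> da /differentiable_mxP dA; apply/differentiable_mxP => i j.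
under eq_fun do rewrite mxE.
exact: differentiable_mul.
Qed.

Lemma derive_scalemx {p q : nat} (a : V -> R) (A : V -> 'M[R]_(p, q)) (x v : V) :
  differentiable a x -> differentiable A x ->
  'D_v (fun y => a y *: A y) x = 'D_v a x *: A x + a x *: 'D_v A x.
Proof.
move=> da dA; apply/matrixP => i j.
rewrite derive_mxE; last exact: differentiable_scalemx.
under eq_fun do rewrite mxE.
have dA' := (differentiable_mxP A x).1 dA i j.
rewrite (@deriveM _ _ a (fun y => A y i j)); try exact: diff_derivable.
by rewrite !mxE -derive_mxE//= addrC; congr (_ + _); rewrite mulrC.
Qed.

Lemma differentiable_bigprod (I : Type) (r : seq I) (P : pred I)
    (f : I -> V -> R) (x : V) :
  (forall i, P i -> differentiable (f i) x) ->
  differentiable (fun y => \prod_(i <- r | P i) f i y) x.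
Proof.
move=> df; elim: r => [|i r IH].
  by under eq_fun do rewrite big_nil; exact: differentiable_cst.
under eq_fun do rewrite big_cons.
have [Pi|//] := boolP (P i).
by apply: differentiable_mul => //; exact: df.
Qed.

Lemma differentiable_det {n : nat} (A : V -> 'M[R]_n) (x : V) :
  differentiable A x -> differentiable (fun y => \det (A y)) x.
Proof.
move=> /differentiable_mxP dA; apply: differentiable_bigsum => s _.
apply: differentiable_mul; first exact: differentiable_cst.
exact: differentiable_bigprod.
Qed.

Lemma differentiable_adjugate {n : nat} (A : V -> 'M[R]_n) (x : V) :
  differentiable A x -> differentiable (fun y => \adj (A y)) x.
Proof.
move=> /differentiable_mxP dA; apply/differentiable_mxP => i j.
under eq_fun do rewrite mxE /cofactor.
apply: differentiable_mul; first exact: differentiable_cst.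
apply: differentiable_det; apply/differentiable_mxP => a b.
by under eq_fun do rewrite !mxE; exact: dA.
Qed.

Lemma differentiable_invmx {n : nat} (A : V -> 'M[R]_n) (x : V) :
  (\forall y \near x, A y \in unitmx) -> differentiable A x ->
  differentiable (fun y => invmx (A y)) x.
Proof.
move=> uA dA.
apply: (@near_eq_differentiable _ (fun y => (\det (A y))^-1 *: \adj (A y))).
  by near=> y; rewrite /invmx ifT//; near: y.
apply: differentiable_scalemx; last exact: differentiable_adjugate.
apply: (differentiableV (differentiable_det dA)).
by rewrite -unitfE; have := nbhs_singleton uA; rewrite unitmxE.
Unshelve. all: by end_near. Qed.

Lemma derive_chain {V' W : normedModType R} (f : V -> V') (g : V' -> W) (x v : V) :
  differentiable f x -> differentiable g (f x) ->
  'D_v (fun y => g (f y)) x = 'D_('D_v f x) g (f x).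
Proof.
move=> df dg; rewrite -[fun y => _]/(g \o f) !deriveE//.
  by rewrite diff_comp.
exact: differentiable_comp.
Qed.

Lemma derive_chain1 (f : V -> R) (g : R -> R) (x v : V) (l : R) :
  differentiable f x -> is_derive (f x) 1 g l ->
  'D_v (fun y => g (f y)) x = l * 'D_v f x.
Proof.
move=> df [dg <-]; rewrite derive_chain//; last exact/derivable1_diffP.
rewrite deriveE; last exact/derivable1_diffP.
rewrite [in RHS]deriveE; last exact/derivable1_diffP.
by rewrite -[X in 'd _ _ X]mulr1 [LHS]linearZ/= mulrC.
Qed.

End Calculus.

Section RowVectors.
Context {R : realType}.

Lemma derive_basis {n : nat} {W : normedModType R} (f : 'rV[R]_n -> W) (x v : 'rV[R]_n) :
  differentiable f x ->
  'D_v f x = \sum_i v 0 i *: 'D_(delta_mx 0 i) f x.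
Proof.
move=> df; rewrite deriveE// {1}(row_sum_delta v) linear_sum.
by apply: eq_bigr => i _; rewrite linearZ/= deriveE.
Qed.

Lemma jacobianE {n p : nat} (f : 'rV[R]_n -> 'rV[R]_p) (x : 'rV[R]_n) i j :
  differentiable f x ->
  jacobian f x i j = 'D_(delta_mx 0 i) (fun y => f y 0 j) x.
Proof. by move=> df; rewrite -derive_mxE// deriveE// mxE. Qed.

Lemma mul_jacobian {n p : nat} (f : 'rV[R]_n -> 'rV[R]_p) (x u : 'rV[R]_n) :
  u *m jacobian f x = 'd f x u.
Proof. by rewrite /jacobian mul_rV_lin1. Qed.

Lemma row_jacobian {n p : nat} (f : 'rV[R]_n -> 'rV[R]_p) (x : 'rV[R]_n) i :
  differentiable f x -> row i (jacobian f x) = 'D_(delta_mx 0 i) f x.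
Proof. by move=> df; rewrite rowE -deriveEjacobian. Qed.

Lemma jacobian_chain {n p q : nat} (f : 'rV[R]_n -> 'rV[R]_p)
    (g : 'rV[R]_p -> 'rV[R]_q) (x : 'rV[R]_n) :
  differentiable f x -> differentiable g (f x) ->
  jacobian (fun y => g (f y)) x = jacobian f x *m jacobian g (f x).
Proof.
move=> df dg; apply/row_matrixP => i.
have dgf : differentiable (fun y => g (f y)) x by exact: differentiable_comp.
by rewrite row_mul !row_jacobian// -(deriveEjacobian _ dg) (derive_chain _ df dg).
Qed.

Lemma jacobian_id {n : nat} (x : 'rV[R]_n) : jacobian (id : 'rV[R]_n -> _) x = 1%:M.
Proof.
apply/row_matrixP => i.
rewrite row_jacobian; last exact: ex_diff.
by rewrite derive_id row1.
Qed.

End RowVectors.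

Local Opaque derive diff jacobian.

(** * Symmetry of second derivatives *)

Section Schwarz.
Context {R : realType} {V : normedModType R}.

Lemma is_derive_line (f : V -> R) (y v : V) (b : R) :
  differentiable f (y + b *: v) ->
  is_derive b 1 (fun b : R => f (y + b *: v)) ('D_v f (y + b *: v)).
Proof.
move=> df.
have dl : is_diff b (fun b : R => y + b *: v) (fun b : R => b *: v).
  have := is_diffD (is_diff_cst y b) (is_diff_scalel b v).
  by rewrite add0r.
have dlb : differentiable (fun b : R => y + b *: v) b by [].
have dc : differentiable (fun b : R => f (y + b *: v)) b.
  exact: (differentiable_comp dlb).
apply: DeriveDef; first exact: diff_derivable.
rewrite (derive_chain _ dlb df); congr ('D__ f _).
by rewrite deriveE// diff_val scale1r.
Qed.

Lemma MVT_line (f : V -> R) (y v : V) (t : R) : 0 < t ->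
  (forall b : R, 0 <= b <= t -> differentiable f (y + b *: v)) ->
  exists2 c : R, 0 <= c <= t & f (y + t *: v) - f y = 'D_v f (y + c *: v) * t.
Proof.
move=> t0 df.
have dd (b : R) : 0 <= b <= t -> is_derive b 1 (fun b : R => f (y + b *: v)) ('D_v f (y + b *: v)).
  by move=> /df; exact: is_derive_line.
have [||c ct] := @MVT_segment _ (fun b : R => f (y + b *: v))
    (fun b => 'D_v f (y + b *: v)) 0 t (ltW t0).
- by move=> b; rewrite in_itv/= => /andP[b0 bt]; apply: dd; rewrite !ltW.
- apply: derivable_within_continuous => b; rewrite in_itv/= => /dd [] //.
by rewrite scale0r addr0 subr0 => ->; exists c.
Qed.

(** The mean value theorem is applied twice: to
    a |-> f (x + a v + t w) - f (x + a v), then to b |-> D_v f (x + a v + b w). *)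
Lemma second_difference (f : V -> R) (v w x : V) (U : set V) : nbhs x U ->
  (forall y, U y -> differentiable f y) ->
  (forall y, U y -> differentiable ('D_v f) y) ->
  exists2 d : R, 0 < d & forall t, 0 < t < d -> exists a b : R,
    [/\ 0 <= a <= t, 0 <= b <= t &
    f (x + t *: v + t *: w) - f (x + t *: v) - (f (x + t *: w) - f x)
      = 'D_w ('D_v f) (x + a *: v + b *: w) * t ^+ 2].
Proof.
move=> /nbhs_ballP[e e0 xU] df ddf.
have n0 : 0 < `|v| + `|w| + 1 by rewrite ltr_wpDl// addr_ge0.
have inU d a b : 0 < d < e / (`|v| + `|w| + 1) -> 0 <= a <= d -> 0 <= b <= d ->
    U (x + a *: v + b *: w).
  move=> /andP[d0 de] /andP[a0 ad] /andP[b0 bd]; apply: xU.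
  rewrite -ball_normE/= -addrA opprD addrA subrr add0r normrN.
  apply: le_lt_trans (ler_normD _ _) _; rewrite !normrZ !ger0_norm//.
  apply: (@le_lt_trans _ _ (d * (`|v| + `|w| + 1))); last by rewrite -ltr_pdivlMr.
  rewrite !mulrDr mulr1 -[X in (X <= _)%R]addr0.
  by apply: lerD (ltW d0); apply: lerD; apply: ler_wpM2r.
exists (e / (`|v| + `|w| + 1)); first exact: divr_gt0.
move=> t td; have /andP[t0 _] := td.
have t00 : 0 <= t <= t by rewrite lexx ltW.
pose h y := f (y + t *: w) - f y.
have dt b y : differentiable f (y + b *: w) -> differentiable (fun y => f (y + b *: w)) y.
  move=> df'; apply: (@differentiable_comp _ _ _ _ (fun y => y + b *: w) f) => //.
have dh a : 0 <= a <= t -> differentiable h (x + a *: v).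
  move=> at_; apply: (@differentiableB _ _ _ (fun y => f (y + t *: w)) f).
    by apply/dt/df/(inU t).
  by apply: df; rewrite -[x + _]addr0 -(scale0r w); apply: (inU t) => //; rewrite lexx ltW.
have [a at_ hE] := MVT_line t0 dh.
have [b bt kE] : exists2 c : R, 0 <= c <= t & 'D_v f (x + a *: v + t *: w) - 'D_v f (x + a *: v)
    = 'D_w ('D_v f) (x + a *: v + c *: w) * t.
  apply: (@MVT_line ('D_v f) (x + a *: v) w t t0) => b bt.
  by apply: ddf; exact: (inU t).
exists a, b; split => //.
rewrite expr2 mulrA -kE.
have d1 : differentiable (fun y => f (y + t *: w)) (x + a *: v) by apply/dt/df/(inU t).
have d2 : differentiable f (x + a *: v).
  by apply: df; rewrite -[x + _]addr0 -(scale0r w); apply: (inU t) => //; rewrite lexx ltW.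
have DhE : 'D_v h (x + a *: v) =
    'D_v f (x + a *: v + t *: w) - 'D_v f (x + a *: v).
  rewrite (@deriveB _ _ _ (fun y => f (y + t *: w)) f); try exact: diff_derivable.
  have dft : differentiable f (x + a *: v + t *: w) by exact/df/(inU t).
  have ds : is_diff (x + a *: v) (fun y => y + t *: w) (id + 0).
    exact: (is_diffD (is_diff_id _) (is_diff_cst (t *: w) (x + a *: v))).
  have dst : differentiable (fun y => y + t *: w) (x + a *: v) by [].
  rewrite (derive_chain v dst dft); congr ('D__ f _ - _).
  by rewrite deriveE// diff_val !fctE addr0.
by rewrite -DhE -hE.
Qed.

Fact subrAC4 (a b c d : R) : a - b - (c - d) = a - c - (b - d).
Proof. by ring. Qed.

Fact ler_dist_half (p q P e : R) : `|p - P| <= e / 2 -> `|q - P| <= e / 2 ->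
  `|p - q| <= e.
Proof.
move=> pP qP; rewrite -(subrKA P) [leRHS]splitr.
by apply: le_trans (ler_normD _ _) (lerD pP _); rewrite distrC.
Qed.

(** The second difference of f is symmetric in v and w. Divided by t^2 it
    is a value, near x, of either iterated derivative. *)
Lemma schwarz (f : V -> R) (v w x : V) (U : set V) : nbhs x U ->
  (forall y, U y -> differentiable f y) ->
  (forall y, U y -> differentiable ('D_v f) y) ->
  (forall y, U y -> differentiable ('D_w f) y) ->
  {for x, continuous ('D_w ('D_v f))} ->
  {for x, continuous ('D_v ('D_w f))} ->
  'D_w ('D_v f) x = 'D_v ('D_w f) x.
Proof.
move=> xU df dvf dwf cwv cvw.
have [d1 d10 sd1] := second_difference w xU df dvf.
have [d2 d20 sd2] := second_difference v xU df dwf.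
apply/eqP; rewrite -subr_eq0 -normr_eq0; apply/eqP/le_anti/andP; split => //.
apply/ler_addgt0Pr => e e0; rewrite add0r.
have e20 : 0 < e / 2 by rewrite divr_gt0.
have [e1 e10 B1] := (nbhs_ballP _ _).1 ((cvgrPdist_le _ _).1 cwv _ e20).
have [e2 e20' B2] := (nbhs_ballP _ _).1 ((cvgrPdist_le _ _).1 cvw _ e20).
pose n := `|v| + `|w| + 1.
have n0 : 0 < n by rewrite ltr_wpDl// addr_ge0.
(* Small enough for both second differences, and for the two intermediate
   points to lie in the balls where continuity is quantified. *)
pose t := Num.min (Num.min d1 d2) (Num.min (e1 / n) (e2 / n)) / 2.
have m0 : 0 < Num.min (Num.min d1 d2) (Num.min (e1 / n) (e2 / n)).
  by rewrite !lt_min d10 d20 !divr_gt0.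
have t0 : 0 < t by rewrite divr_gt0.
have : t < Num.min (Num.min d1 d2) (Num.min (e1 / n) (e2 / n)).
  by rewrite /t ltr_pdivrMr// ltr_pMr// ltr1n.
rewrite !lt_min => /andP[/andP[td1 td2] /andP[te1 te2]].
have inB r a b u1 u2 : t < r / n -> `|u1| + `|u2| + 1 = n -> 0 <= a <= t -> 0 <= b <= t ->
    ball x r (x + a *: u1 + b *: u2).
  move=> tr un /andP[a0 at_] /andP[b0 bt].
  rewrite -ball_normE/= -addrA opprD addrA subrr add0r normrN.
  apply: le_lt_trans (ler_normD _ _) _; rewrite !normrZ !ger0_norm//.
  apply: (@le_lt_trans _ _ (t * n)); last by rewrite -ltr_pdivlMr.
  rewrite -un !mulrDr mulr1 -[X in (X <= _)%R]addr0.
  by apply: lerD (ltW t0); apply: lerD; apply: ler_wpM2r.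
have [|a [b [at_ bt sE]]] := sd1 t; first by rewrite t0.
have [|a' [b' [at' bt' sE']]] := sd2 t; first by rewrite t0.
have PQ : 'D_w ('D_v f) (x + a *: v + b *: w) = 'D_v ('D_w f) (x + a' *: w + b' *: v).
  apply: (@mulIf _ (t ^+ 2)); first by rewrite expf_neq0// gt_eqF.
  have A' : f (x + t *: v + t *: w) = f (x + t *: w + t *: v) := congr1 f (addrAC _ _ _).
  apply: etrans (esym sE) (etrans (subrAC4 _ _ _ _) (etrans _ sE')).
  exact: (congr1 (fun u => u - f (x + t *: w) - (f (x + t *: v) - f x)) A').
have := B1 _ (inB _ _ _ _ _ te1 erefl at_ bt).
have := B2 _ (inB _ _ _ _ _ te2 (congr1 (+%R^~ 1) (addrC _ _)) at' bt').
by rewrite -PQ => QP PP; exact: ler_dist_half PP QP.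
Qed.

End Schwarz.

(** * The divergence in coordinates *)

(** The divergence of X for the metric with Gram matrix G: the second term is
    the derivative of log sqrt (det G) along X. *)
Definition ldiv {R : realType} {n : nat} (G : 'rV[R]_n -> 'M[R]_n)
    (X : 'rV[R]_n -> 'rV[R]_n) (x : 'rV[R]_n) : R :=
  \tr (jacobian X x) + 2^-1 * \tr (invmx (G x) *m 'D_(X x) G x).

Section LocalDivergence.
Context {R : realType} {n : nat}.
Implicit Types (G : 'rV[R]_n -> 'M[R]_n) (X : 'rV[R]_n -> 'rV[R]_n).

Lemma near_eq_jacobian {p : nat} (f g : 'rV[R]_n -> 'rV[R]_p) x :
  {near x, f =1 g} -> differentiable f x -> jacobian f x = jacobian g x.
Proof.
move=> fg df; apply/row_matrixP => i.
have dg := near_eq_differentiable fg df.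
rewrite [LHS]row_jacobian; last exact: df.
rewrite [RHS]row_jacobian; last exact: dg.
by apply: near_eq_derive; exact: fg.
Qed.

Lemma near_eq_ldiv G X Y x :
  {near x, X =1 Y} -> differentiable X x -> ldiv G X x = ldiv G Y x.
Proof.
move=> XY dX; rewrite /ldiv (near_eq_jacobian XY dX).
by rewrite (nbhs_singleton XY).
Qed.

Lemma deriveD_dir {W : normedModType R} (f : 'rV[R]_n -> W) (x v w : 'rV[R]_n) :
  differentiable f x -> 'D_(v + w) f x = 'D_v f x + 'D_w f x.
Proof. by move=> df; rewrite !deriveE// linearD. Qed.

Lemma deriveZ_dir {W : normedModType R} (f : 'rV[R]_n -> W) (x v : 'rV[R]_n) (a : R) :
  differentiable f x -> 'D_(a *: v) f x = a *: 'D_v f x.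
Proof. by move=> df; rewrite !deriveE// linearZ. Qed.

Lemma jacobianD X Y x : differentiable X x -> differentiable Y x ->
  jacobian (fun y => X y + Y y) x = jacobian X x + jacobian Y x.
Proof.
move=> dX dY; apply/row_matrixP => i; have dXY := differentiable_add dX dY.
rewrite [LHS](row_jacobian i dXY) [RHS]linearD/=.
rewrite [LHS]deriveD; [|exact: diff_derivable|exact: diff_derivable].
apply: f_equal2; apply: esym; exact: row_jacobian.
Qed.

Lemma jacobianZ (a : 'rV[R]_n -> R) X x : differentiable a x -> differentiable X x ->
  jacobian (fun y => a y *: X y) x =
  a x *: jacobian X x + (\row_i 'D_(delta_mx 0 i) a x)^T *m X x.
Proof.
move=> da dX; apply/row_matrixP => i; have daX := differentiable_scalemx da dX.
rewrite [LHS](row_jacobian i daX) (derive_scalemx _ da dX) [RHS]linearD/= linearZ/=.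
rewrite row_jacobian; last exact: dX.
rewrite [LHS]addrC; apply: f_equal2; first by [].
rewrite row_mul; apply/rowP => j.
by rewrite !mxE big_ord1 !mxE.
Qed.

Lemma ldivD G X Y x : differentiable G x -> differentiable X x -> differentiable Y x ->
  ldiv G (fun y => X y + Y y) x = ldiv G X x + ldiv G Y x.
Proof.
move=> dG dX dY; rewrite /ldiv jacobianD// deriveD_dir// mulmxDr !linearD/= mulrDr.
exact: addrACA.
Qed.

Lemma ldivZ G (a : 'rV[R]_n -> R) X x :
  differentiable G x -> differentiable a x -> differentiable X x ->
  ldiv G (fun y => a y *: X y) x = a x * ldiv G X x + 'D_(X x) a x.
Proof.
move=> dG da dX; rewrite /ldiv jacobianZ// deriveZ_dir// -scalemxAr !linearD/= !linearZ/=.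
have -> : \tr ((\row_i 'D_(delta_mx 0 i) a x)^T *m X x) = 'D_(X x) a x.
  rewrite mxtrace_mulC (derive_basis _ da) /mxtrace big_ord1 mxE.
  by apply: eq_bigr => i _; rewrite !mxE.
by rewrite mulrCA addrAC -mulrDr.
Qed.

(** The logarithmic derivative of det (J G J^T); J and J^T contribute the same
    amount. *)
Lemma mxtrace_congruence (J G DJ DG : 'M[R]_n) : J \in unitmx -> G \in unitmx ->
  \tr (invmx (J *m G *m J^T) *m
    (DJ *m G *m J^T + J *m DG *m J^T + J *m G *m DJ^T)) =
  \tr (invmx J *m DJ) + \tr (invmx G *m DG) + \tr (invmx J *m DJ).
Proof.
move=> Ju Gu; have JTu : J^T \in unitmx by rewrite unitmx_tr.
have -> : invmx (J *m G *m J^T) = invmx J^T *m (invmx G *m invmx J).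
  have Au : J *m G *m J^T \in unitmx by rewrite !unitmx_mul Ju Gu.
  have AB : J *m G *m J^T *m (invmx J^T *m (invmx G *m invmx J)) = 1%:M.
    by rewrite !mulmxA mulmxK// mulmxK// mulmxV.
  by rewrite -[RHS](mulKmx Au) AB mulmx1.
rewrite !mulmxDr !linearD/=; congr (_ + _ + _).
- by rewrite mxtrace_mulC !mulmxA mulmxK// mulmxK// mxtrace_mulC.
- rewrite mxtrace_mulC !mulmxA mulmxK// mxtrace_mulC !mulmxA mulVmx// mul1mx.
  by rewrite mxtrace_mulC.
- by rewrite -!mulmxA mulKmx// mulKmx// -trmx_inv -trmx_mul mxtrace_tr mxtrace_mulC.
Qed.

Fact half_twice (a b c : R) : a + b + 2^-1 * c = a + 2^-1 * (b + c + b).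
Proof. by field. Qed.

(** By the symmetry of second derivatives, tr (D X0) exceeds tr (DX) by
    tr (J^-1 D_X J). The half trace of G^-1 D_X G exceeds the corresponding term
    of G0 by the same amount, so the two corrections compensate. *)
Lemma ldiv_change (tau : 'rV[R]_n -> 'rV[R]_n) G X G0 X0 (x : 'rV[R]_n) :
  (\forall y \near x, differentiable tau y) ->
  differentiable (jacobian tau) x ->
  (forall v w, v *m 'D_w (jacobian tau) x = w *m 'D_v (jacobian tau) x) ->
  jacobian tau x \in unitmx -> G0 (tau x) \in unitmx ->
  differentiable G0 (tau x) -> differentiable X x -> differentiable X0 (tau x) ->
  (\forall y \near x, X0 (tau y) = X y *m jacobian tau y) ->
  (\forall y \near x, G y = jacobian tau y *m G0 (tau y) *m (jacobian tau y)^T) ->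
  ldiv G X x = ldiv G0 X0 (tau x).
Proof.
set J := jacobian tau => dtau dJ sym Ju Gu dG0 dX dX0 X0E GE.
have dtaux := nbhs_singleton dtau.
have X0x := nbhs_singleton X0E.
have dXJ : differentiable (fun y => X y *m J y) x by exact: differentiable_mulmx.
have JX0 : J x *m jacobian X0 (tau x) = jacobian X x *m J x + 'D_(X x) J x.
  apply: etrans (esym (jacobian_chain dtaux dX0)) _.
  rewrite [LHS](near_eq_jacobian X0E); last exact: (differentiable_comp dtaux).
  apply/row_matrixP => i.
  rewrite [LHS](row_jacobian i dXJ) (derive_mulmx _ dX dJ) [RHS]linearD/= row_mul.
  by rewrite (row_jacobian i dX) sym -rowE.
have trX0 : \tr (jacobian X0 (tau x)) =
    \tr (jacobian X x) + \tr (invmx (J x) *m 'D_(X x) J x).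
  rewrite -(mulKmx Ju (jacobian X0 _)) JX0 mulmxDr [LHS]linearD/=.
  by apply: f_equal2 => //; rewrite mulmxA mxtrace_mulC mulmxA mulmxV// mul1mx.
have dG0t : differentiable (fun y => G0 (tau y)) x by exact: (differentiable_comp dtaux).
have dJT := differentiable_trmx dJ.
have DG : 'D_(X x) G x = 'D_(X x) J x *m G0 (tau x) *m (J x)^T
    + J x *m 'D_(X0 (tau x)) G0 (tau x) *m (J x)^T
    + J x *m G0 (tau x) *m ('D_(X x) J x)^T.
  have dJG : differentiable (fun y => J y *m G0 (tau y)) x by exact: differentiable_mulmx.
  rewrite (near_eq_derive _ GE) (derive_mulmx _ dJG dJT) (derive_mulmx _ dJ dG0t).
  rewrite (derive_trmx _ dJ) (derive_chain _ dtaux dG0).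
  by rewrite (deriveEjacobian _ dtaux) -X0x mulmxDl.
rewrite [LHS]/ldiv [in LHS]DG [in LHS](nbhs_singleton GE).
rewrite [in LHS]mxtrace_congruence//.
by rewrite [RHS]/ldiv [in RHS]trX0 half_twice.
Qed.

End LocalDivergence.

(** * Closure properties of smooth maps *)

Section Smooth.
Context {R : realType}.
Implicit Types (n p q k : nat).

Lemma open_near {T : topologicalType} (U : set T) (x : T) : open U -> U x ->
  \forall y \near x, U y.
Proof. by move=> oU Ux; exact: open_nbhs_nbhs. Qed.

Lemma Cn_ext {n} {W : normedModType R} k (U : set 'rV[R]_n) (f g : 'rV[R]_n -> W) :
  open U -> (forall x, U x -> f x = g x) -> Cn k U f -> Cn k U g.
Proof.
move=> oU; have nearU f' g' x : (forall x, U x -> f' x = g' x :> W) -> U x ->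
    {near x, f' =1 g'}.
  by move=> fg Ux; apply: filterS (open_near oU Ux) => y; exact: fg.
elim: k f g => [|k IH] f g fg.
  move=> cf x Ux; have cfx : f @ x --> f x := cf x Ux.
  rewrite /prop_for /continuous_at -(fg x Ux).
  have fgx : \forall y \near x, f y = g y by exact: nearU.
  exact: cvg_trans (near_eq_cvg fgx) cfx.
move=> [df Df]; split=> [x Ux|v].
  exact: near_eq_differentiable (nearU _ _ _ fg Ux) (df x Ux).
apply: IH (Df v) => x Ux; apply: near_eq_derive; exact: nearU.
Qed.

Lemma Cn_sub {n} {W : normedModType R} k (U U' : set 'rV[R]_n) (f : 'rV[R]_n -> W) :
  U' `<=` U -> Cn k U f -> Cn k U' f.
Proof.
move=> sU; elim: k f => [|k IH] f /=; first by move=> cf x /sU; exact: cf.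
by move=> [df Df]; split=> [x /sU/df//|v]; exact: IH.
Qed.

Lemma CnS {n} {W : normedModType R} k (U : set 'rV[R]_n) (f : 'rV[R]_n -> W) :
  Cn k.+1 U f -> Cn k U f.
Proof.
elim: k f => [|k IH] f; first by move=> [df _] x Ux; exact: differentiable_continuous (df x Ux).
by move=> [df Df]; split=> // v; apply: IH; exact: Df.
Qed.

Lemma Cn_cst {n} {W : normedModType R} k (U : set 'rV[R]_n) (a : W) : Cn k U (cst a).
Proof.
elim: k a => [|k IH] a /=; first by move=> x _; exact: cst_continuous.
split=> [x _|v]; first exact: differentiable_cst.
by under eq_fun do rewrite derive_cst; exact: IH.
Qed.

Lemma Cn_linear {n} {W : normedModType R} k (U : set 'rV[R]_n)
    (f : {linear 'rV[R]_n -> W}) : continuous f -> Cn k U f.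
Proof.
move=> cf; case: k => [|k] /=; first by move=> x _; exact: cf.
split=> [x _|v]; first exact: linear_differentiable.
rewrite (_ : (fun x => _) = cst (f v)); first exact: Cn_cst.
by apply/funext => x; rewrite deriveE ?diff_lin//; exact: linear_differentiable.
Qed.

Lemma Cn_mxP {n p q} k (U : set 'rV[R]_n) (A : 'rV[R]_n -> 'M[R]_(p, q)) :
  open U -> Cn k U A <-> forall i j, Cn k U (fun x => A x i j).
Proof.
move=> oU; elim: k A => [|k IH] A /=.
  split=> [cA i j x Ux|cA x Ux].
    apply: (@continuous_comp _ _ _ A (fun M => M i j)); first exact: cA.
    exact: coord_continuous.
  apply: (cvgrPdist_le (FF := nbhs_filter x) _ _).2 => e e0.
  near=> y; rewrite /Num.Def.normr/= mx_normrE (bigmax_le _ (ltW e0))//= => i _.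
  rewrite !mxE; move: i; near: y; apply: filter_forall => /= i.
  exact: ((cvgrPdist_le (FF := nbhs_filter x) _ _).1 (cA i.1 i.2 x Ux) e e0).
have DE x v i j : differentiable A x ->
    'D_v A x i j = 'D_v (fun x => A x i j) x by exact: derive_mxE.
split=> [[dA DA] i j|CA].
  split=> [x Ux|v]; first exact: (differentiable_mxP _ _).1 (dA x Ux) i j.
  have := (IH _).1 (DA v) i j; apply: Cn_ext => // x Ux.
  by rewrite DE//; exact: dA.
have dA x : U x -> differentiable A x.
  by move=> Ux; apply/differentiable_mxP => i j; exact: (CA i j).1.
split=> // v; apply/IH => i j.
apply: Cn_ext ((CA i j).2 v) => // x Ux.
by rewrite DE//; exact: dA.
Unshelve. all: by end_near. Qed.

Lemma Cn_add {n} {W : normedModType R} k (U : set 'rV[R]_n) (f g : 'rV[R]_n -> W) :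
  open U -> Cn k U f -> Cn k U g -> Cn k U (fun x => f x + g x).
Proof.
move=> oU; elim: k f g => [|k IH] f g /=.
  by move=> cf cg x Ux; apply: continuousD; [exact: cf|exact: cg].
move=> [df Df] [dg Dg]; split=> [x Ux|v].
  by apply: differentiable_add; [exact: df|exact: dg].
apply: Cn_ext (IH _ _ (Df v) (Dg v)) => // x Ux.
by rewrite [RHS]deriveD//; apply: diff_derivable; [exact: df|exact: dg].
Qed.

Lemma Cn_mul {n} k (U : set 'rV[R]_n) (f g : 'rV[R]_n -> R) :
  open U -> Cn k U f -> Cn k U g -> Cn k U (fun x => f x * g x).
Proof.
move=> oU; elim: k f g => [|k IH] f g.
  by move=> cf cg x Ux; apply: continuousM; [exact: cf|exact: cg].
move=> Cf Cg; have [df Df] := Cf; have [dg Dg] := Cg; split=> [x Ux|v].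
  by apply: differentiable_mul; [exact: df|exact: dg].
apply: Cn_ext (Cn_add oU (IH _ _ (CnS Cf) (Dg v)) (IH _ _ (CnS Cg) (Df v))) => // x Ux.
by rewrite [RHS]deriveM//; apply: diff_derivable; [exact: df|exact: dg].
Qed.

Lemma Cn_inv {n} k (U : set 'rV[R]_n) (f : 'rV[R]_n -> R) :
  open U -> (forall x, U x -> f x != 0) -> Cn k U f -> Cn k U (fun x => (f x)^-1).
Proof.
move=> oU f0; elim: k => [|k IH].
  by move=> cf x Ux; apply: continuousV; [exact: f0|exact: cf].
move=> Cf; have [df Df] := Cf; split=> [x Ux|v].
  by apply: (differentiableV (df x Ux)); exact: f0.
have CV := IH (CnS Cf).
have := Cn_mul oU (@Cn_cst _ R k U (-1)) (Cn_mul oU (Cn_mul oU CV CV) (Df v)).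
apply: Cn_ext => // x Ux /=.
rewrite [RHS](deriveV (f0 x Ux) (diff_derivable (df x Ux))).
by rewrite mulN1r expr2 invfM scaleNr.
Qed.

Lemma Cn_sum {n} {W : normedModType R} k (U : set 'rV[R]_n) (I : Type) (r : seq I)
    (P : pred I) (f : I -> 'rV[R]_n -> W) :
  open U -> (forall i, P i -> Cn k U (f i)) ->
  Cn k U (fun x => \sum_(i <- r | P i) f i x).
Proof.
move=> oU Cf; elim: r => [|i r IH].
  by under eq_fun do rewrite big_nil; exact: Cn_cst.
under eq_fun do rewrite big_cons.
have [Pi|//] := boolP (P i).
by apply: Cn_add => //; exact: Cf.
Qed.

Lemma Cn_prod {n} k (U : set 'rV[R]_n) (I : Type) (r : seq I)
    (P : pred I) (f : I -> 'rV[R]_n -> R) :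
  open U -> (forall i, P i -> Cn k U (f i)) ->
  Cn k U (fun x => \prod_(i <- r | P i) f i x).
Proof.
move=> oU Cf; elim: r => [|i r IH].
  by under eq_fun do rewrite big_nil; exact: Cn_cst.
under eq_fun do rewrite big_cons.
have [Pi|//] := boolP (P i).
by apply: Cn_mul => //; exact: Cf.
Qed.

(** The derivatives of f o g are sums of products of derivatives of g with
    derivatives of f composed with g; this is what makes the induction on k
    go through. *)
Lemma Cn_comp {n p} k (U : set 'rV[R]_n) (U' : set 'rV[R]_p)
    (g : 'rV[R]_n -> 'rV[R]_p) (f : 'rV[R]_p -> R) :
  open U -> (forall x, U x -> U' (g x)) -> Cn k U g -> Cn k U' f ->
  Cn k U (fun x => f (g x)).
Proof.
move=> oU gU; elim: k f => [|k IH] f.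
  by move=> cg cf x Ux; apply: (@continuous_comp _ _ _ g f); [exact: cg|exact/cf/gU].
move=> Cg [df Df]; have [dg Dg] := Cg; split=> [x Ux|v].
  by apply: (@differentiable_comp _ _ _ _ g f); [exact: dg|exact/df/gU].
have C : Cn k U (fun x => \sum_i ('D_v g x) 0 i * 'D_(delta_mx 0 i) f (g x)).
  apply: Cn_sum => // i _; apply: Cn_mul => //.
    exact: (Cn_mxP _ _ oU).1 (Dg v) 0 i.
  exact: (IH ('D_(delta_mx 0 i) f) (CnS Cg) (Df _)).
apply: Cn_ext C => // x Ux.
have dfx := df _ (gU x Ux).
by rewrite (derive_chain v (dg x Ux) dfx) (derive_basis _ dfx).
Qed.

Lemma Cn_mulmx {n p q s} k (U : set 'rV[R]_n) (A : 'rV[R]_n -> 'M[R]_(p, q))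
    (B : 'rV[R]_n -> 'M[R]_(q, s)) :
  open U -> Cn k U A -> Cn k U B -> Cn k U (fun x => A x *m B x).
Proof.
move=> oU /(Cn_mxP _ _ oU) CA /(Cn_mxP _ _ oU) CB; apply/Cn_mxP => // i j.
under eq_fun do rewrite mxE.
by apply: Cn_sum => // l _; exact: Cn_mul.
Qed.

Lemma Cn_det {n p} k (U : set 'rV[R]_n) (A : 'rV[R]_n -> 'M[R]_p) :
  open U -> Cn k U A -> Cn k U (fun x => \det (A x)).
Proof.
move=> oU /(Cn_mxP _ _ oU) CA; apply: Cn_sum => // s _.
by apply: Cn_mul => //; [exact: Cn_cst|exact: Cn_prod].
Qed.

Lemma Cn_invmx {n p} k (U : set 'rV[R]_n) (A : 'rV[R]_n -> 'M[R]_p) :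
  open U -> (forall x, U x -> A x \in unitmx) -> Cn k U A ->
  Cn k U (fun x => invmx (A x)).
Proof.
move=> oU uA CA; have CA' := (Cn_mxP _ _ oU).1 CA.
apply/Cn_mxP => // i j.
have C : Cn k U (fun x => (\det (A x))^-1 * ((-1) ^+ (j + i) * \det (row' j (col' i (A x))))).
  apply: Cn_mul => //.
    apply: Cn_inv => // [x Ux|]; last exact: Cn_det.
    by rewrite -unitfE -unitmxE; exact: uA.
  apply: Cn_mul => //; first exact: Cn_cst.
  apply: Cn_det => //; apply/Cn_mxP => // a b.
  by under eq_fun do rewrite !mxE; exact: CA'.
by apply: Cn_ext C => // x Ux; rewrite /invmx uA// !mxE.
Qed.

Lemma smooth_differentiable {n} {W : normedModType R} (U : set 'rV[R]_n) (f : 'rV[R]_n -> W) x :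
  smooth_on U f -> U x -> differentiable f x.
Proof. by move=> /(_ 1%N) [df _]; exact: df. Qed.

Lemma smooth_derive {n} {W : normedModType R} (U : set 'rV[R]_n) (f : 'rV[R]_n -> W) v :
  smooth_on U f -> smooth_on U ('D_v f).
Proof. by move=> sf k; have [_ Df] := sf k.+1; exact: Df. Qed.

Lemma smooth_mxP {n p q} (U : set 'rV[R]_n) (A : 'rV[R]_n -> 'M[R]_(p, q)) :
  open U -> smooth_on U A <-> forall i j, smooth_on U (fun x => A x i j).
Proof.
move=> oU; split=> [sA i j k|sA k]; first exact: (Cn_mxP k A oU).1 (sA k) i j.
by apply/Cn_mxP => // i j; exact: sA.
Qed.

Lemma smooth_jacobian {n p} (U : set 'rV[R]_n) (f : 'rV[R]_n -> 'rV[R]_p) :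
  open U -> smooth_on U f -> smooth_on U (jacobian f).
Proof.
move=> oU sf; apply/smooth_mxP => // i j k.
have := (smooth_mxP _ oU).1 (smooth_derive (delta_mx 0 i) sf) 0 j k.
apply: Cn_ext => // x Ux; rewrite deriveE ?mxE//.
exact: smooth_differentiable sf Ux.
Qed.

(** Symmetry of second derivatives in the form used by [ldiv_change]. *)
Lemma smooth_jacobian_sym {n p} (U : set 'rV[R]_n) (f : 'rV[R]_n -> 'rV[R]_p) x v w :
  open U -> smooth_on U f -> U x ->
  v *m 'D_w (jacobian f) x = w *m 'D_v (jacobian f) x.
Proof.
move=> oU sf Ux; have sJ := smooth_jacobian oU sf.
have JE u u' : u *m 'D_u' (jacobian f) x = 'D_u' ('D_u f) x.
  have -> : 'D_u' ('D_u f) x = 'D_u' (fun y => u *m jacobian f y) x.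
    apply: near_eq_derive; apply: filterS (open_near oU Ux) => y Uy.
    by rewrite deriveEjacobian//; exact: smooth_differentiable sf Uy.
  have dJ := smooth_differentiable sJ Ux.
  by rewrite (derive_mulmx _ (differentiable_cst u x) dJ) derive_cst mul0mx add0r.
rewrite !JE; apply/rowP => j.
have DE u y : U y -> 'D_u f y 0 j = 'D_u (fun z => f z 0 j) y.
  by move=> Uy; rewrite derive_mxE//; exact: smooth_differentiable sf Uy.
have sfj := (smooth_mxP _ oU).1 sf 0 j.
have DDE u u' : 'D_u' ('D_u f) x 0 j = 'D_u' ('D_u (fun z => f z 0 j)) x.
  rewrite derive_mxE; last exact: smooth_differentiable (smooth_derive _ sf) Ux.
  by apply: near_eq_derive; apply: filterS (open_near oU Ux) => y; exact: DE.
apply: etrans (DDE v w) (etrans _ (esym (DDE w v))).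
apply: (@schwarz _ _ _ v w x U); first exact: open_nbhs_nbhs.
- by move=> y; exact: smooth_differentiable.
- by move=> y; apply: smooth_differentiable; exact: smooth_derive.
- by move=> y; apply: smooth_differentiable; exact: smooth_derive.
- exact: (smooth_derive w (smooth_derive v sfj) 0%N).
- exact: (smooth_derive v (smooth_derive w sfj) 0%N).
Qed.

End Smooth.

(** * Charts of a manifold *)

Section Charts.
Context {R : realType} {n : nat} {M : manifold R n}.
Implicit Types (c : chart R n M) (p : M).

Lemma chart_at_atlas p : atlas M (chart_at p).
Proof. by rewrite /chart_at; case: cid => c []. Qed.

Lemma chart_at_dom p : cdom (chart_at p) p.
Proof. by rewrite /chart_at; case: cid => c []. Qed.

Definition overlap c c' : set 'rV[R]_n := cmap c @` (cdom c `&` cdom c').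

Lemma overlapP c c' x : atlas M c ->
  overlap c c' x <-> [/\ cimg c x, cdom c (cinv c x) & cdom c' (cinv c x)].
Proof.
move=> ac; have cc := atlas_chart ac; split=> [[p [pc pc'] <-]|[[p pc <-]]].
  by rewrite (cmapK cc pc); split=> //; exists p.
by rewrite (cmapK cc pc) => _ pc'; exists p.
Qed.

Lemma cimgP c x : atlas M c -> cimg c x -> cdom c (cinv c x) /\ cmap c (cinv c x) = x.
Proof. by move=> ac [p pc <-]; rewrite (cmapK (atlas_chart ac) pc). Qed.

Lemma open_cinv_preimage c (U : set M) : atlas M c -> open U ->
  open (cimg c `&` cinv c @^-1` U).
Proof.
move=> ac oU; have cc := atlas_chart ac.
rewrite openE => x [xc xU]; apply: filterI.
  by apply: open_nbhs_nbhs; split => //; exact: cimg_open cc.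
by apply: (cinv_cont cc xc); apply: open_nbhs_nbhs.
Qed.

Lemma open_overlap c c' : atlas M c -> atlas M c' -> open (overlap c c').
Proof.
move=> ac ac'; have oU := cdom_open (atlas_chart ac').
rewrite (_ : overlap c c' = cimg c `&` cinv c @^-1` (cdom c')); first exact: open_cinv_preimage.
apply/seteqP; split=> x; first by move=> /(overlapP _ _ ac)[].
by move=> [xc xc']; apply/(overlapP _ _ ac); split=> //; have [] := cimgP ac xc.
Qed.

Lemma overlap_cmap c c' p : cdom c p -> cdom c' p -> overlap c c' (cmap c p).
Proof. by move=> pc pc'; exists p. Qed.

Definition trans c c' : 'rV[R]_n -> 'rV[R]_n := cmap c' \o cinv c.

Lemma trans_cmap c c' p : atlas M c -> cdom c p -> trans c c' (cmap c p) = cmap c' p.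
Proof. by move=> ac pc; rewrite /trans/= (cmapK (atlas_chart ac)). Qed.

Lemma trans_smooth c c' : atlas M c -> atlas M c' -> smooth_on (overlap c c') (trans c c').
Proof. by move=> ac ac'; exact: atlas_smooth. Qed.

Lemma trans_differentiable c c' p : atlas M c -> atlas M c' -> cdom c p -> cdom c' p ->
  differentiable (trans c c') (cmap c p).
Proof.
move=> ac ac' pc pc'; apply: smooth_differentiable (trans_smooth ac ac') _.
exact: overlap_cmap.
Qed.

Lemma jacobian_trans c c' c'' p : atlas M c -> atlas M c' -> atlas M c'' ->
  cdom c p -> cdom c' p -> cdom c'' p ->
  jacobian (trans c c') (cmap c p) *m jacobian (trans c' c'') (cmap c' p) =
  jacobian (trans c c'') (cmap c p).
Proof.
move=> ac ac' ac'' pc pc' pc''.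
have d1 := trans_differentiable ac ac' pc pc'.
have d2 := trans_differentiable ac' ac'' pc' pc''.
rewrite -(trans_cmap c' ac pc) in d2 *.
rewrite -[LHS](jacobian_chain d1 d2); apply: near_eq_jacobian; last first.
  exact: (differentiable_comp d1 d2).
have oW := open_overlap ac ac'.
have xW : overlap c c' (cmap c p) by exact: overlap_cmap.
apply: filterS (open_near oW xW) => x /(overlapP _ _ ac)[xc xd xd'].
by rewrite /trans/= (cmapK (atlas_chart ac')).
Qed.

Lemma jacobian_transxx c p : atlas M c -> cdom c p ->
  jacobian (trans c c) (cmap c p) = 1%:M.
Proof.
move=> ac pc; rewrite -[RHS](jacobian_id (cmap c p)); apply: near_eq_jacobian; last first.
  exact: trans_differentiable.
have oW := cimg_open (atlas_chart ac).
have xW : cimg c (cmap c p) by exists p.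
by apply: filterS (open_near oW xW) => x /(cimgP ac)[].
Qed.

Lemma jacobian_trans_unit c c' p : atlas M c -> atlas M c' ->
  cdom c p -> cdom c' p -> jacobian (trans c c') (cmap c p) \in unitmx.
Proof.
move=> ac ac' pc pc'; apply: (proj1 (mulmx1_unit (B := jacobian (trans c' c) (cmap c' p)) _)).
by rewrite jacobian_trans// jacobian_transxx.
Qed.

Lemma tcompE c p (X : tangent p) :
  tcomp c X = (X : 'rV[R]_n) *m jacobian (trans (chart_at p) c) (cmap (chart_at p) p).
Proof. by rewrite mul_jacobian. Qed.

Lemma tcomp_change c c' p (X : tangent p) : atlas M c -> atlas M c' ->
  cdom c p -> cdom c' p ->
  tcomp c' X = tcomp c X *m jacobian (trans c c') (cmap c p).
Proof.
move=> ac ac' pc pc'; rewrite !tcompE -mulmxA jacobian_trans//.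
  exact: chart_at_atlas.
exact: chart_at_dom.
Qed.

(** The inverse of [tcomp c] on the tangent space at p. *)
Definition tvec c p (a : 'rV[R]_n) : tangent p :=
  a *m jacobian (trans c (chart_at p)) (cmap c p).

Lemma tvecK c p (a : 'rV[R]_n) : atlas M c -> cdom c p -> tcomp c (tvec c p a) = a.
Proof.
move=> ac pc; rewrite tcompE /tvec -mulmxA jacobian_trans ?jacobian_transxx ?mulmx1//.
  exact: chart_at_atlas.
exact: chart_at_dom.
Qed.

Lemma tcompK c p (X : tangent p) : atlas M c -> cdom c p -> tvec c p (tcomp c X) = X.
Proof.
move=> ac pc; rewrite tcompE /tvec -mulmxA jacobian_trans.
- rewrite jacobian_transxx; first exact: mulmx1.
    exact: chart_at_atlas.
  exact: chart_at_dom.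
- exact: chart_at_atlas.
- by [].
- exact: chart_at_atlas.
- exact: chart_at_dom.
- by [].
- exact: chart_at_dom.
Qed.

Lemma coord_vecE c p i : coord_vec c p i = tvec c p (delta_mx 0 i).
Proof. by rewrite /tvec mul_jacobian. Qed.

Lemma tcomp_linear c p : linear (fun X : tangent p => tcomp c X).
Proof. by move=> a X Y; rewrite !tcompE mulmxDl -scalemxAl. Qed.

End Charts.

(** * Metric, gradient and divergence in a chart *)

Definition drow {R : realType} {n : nat} (w : 'rV[R]_n -> R) (x : 'rV[R]_n) : 'rV[R]_n :=
  \row_i 'D_(delta_mx 0 i) w x.

Lemma drow_mul {R : realType} {n : nat} (w : 'rV[R]_n -> R) (x a : 'rV[R]_n) :
  differentiable w x -> (drow w x *m a^T) 0 0 = 'D_a w x.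
Proof.
move=> dw; rewrite (derive_basis _ dw) mxE; apply: eq_bigr => i _.
by rewrite !mxE mulrC.
Qed.

Section Metric.
Context {R : realType} {n : nat} {M : manifold R n} (g : riemannian_metric M).
Implicit Types (c : chart R n M) (p : M).

Lemma metric_suml p (I : Type) (r : seq I) (a : I -> R) (X : I -> tangent p) (Y : tangent p) :
  g p (\sum_(i <- r) a i *: X i) Y = \sum_(i <- r) a i * g p (X i) Y.
Proof.
have glin := metric_linear g Y.
elim: r => [|i r IH].
  rewrite !big_nil; have := glin (-1) 0 0.
  by rewrite scaleN1r oppr0 addr0 mulN1r addNr.
rewrite !big_cons -IH; exact: glin.
Qed.

Lemma metric_sumr p (I : Type) (r : seq I) (a : I -> R) (X : I -> tangent p) (Y : tangent p) :
  g p Y (\sum_(i <- r) a i *: X i) = \sum_(i <- r) a i * g p Y (X i).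
Proof.
by rewrite Defs.metric_sym metric_suml; apply: eq_bigr => i _; rewrite (Defs.metric_sym g (X i)).
Qed.

Lemma tvec_sum c p (a : 'rV[R]_n) : tvec c p a = \sum_i a 0 i *: coord_vec c p i.
Proof.
rewrite /tvec {1}(row_sum_delta a) mulmx_suml; apply: eq_bigr => i _.
by rewrite coord_vecE /tvec scalemxAl.
Qed.

(** This and its analogue [fmetric_tcoord] replace points and fibres, which
    vary with the base point, by matrices. *)
Lemma metric_gram c p (X Y : tangent p) : atlas M c -> cdom c p ->
  g p X Y = (tcomp c X *m gram g c (cmap c p) *m (tcomp c Y)^T) 0 0.
Proof.
move=> ac pc; rewrite -{1}(tcompK X ac pc) -{1}(tcompK Y ac pc) !tvec_sum metric_suml.
under eq_bigr do rewrite metric_sumr.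
rewrite mxE; under [RHS]eq_bigr do rewrite !mxE mulr_suml.
rewrite exchange_big/=; apply: eq_bigr => i _; rewrite mulr_sumr; apply: eq_bigr => j _.
by rewrite !mxE (cmapK (atlas_chart ac) pc) mulrAC mulrA.
Qed.

Lemma mx_bilinear_inj (A B : 'M[R]_n) :
  (forall a b : 'rV[R]_n, (a *m A *m b^T) 0 0 = (a *m B *m b^T) 0 0) -> A = B.
Proof.
move=> AB; apply/matrixP => i j.
have := AB (delta_mx 0 i) (delta_mx 0 j).
by rewrite -!rowE trmx_delta -!colE !mxE.
Qed.

Lemma gram_sym c x : (gram g c x)^T = gram g c x.
Proof. by apply/matrixP => i j; rewrite !mxE Defs.metric_sym. Qed.

Lemma gram_unit c p : atlas M c -> cdom c p -> gram g c (cmap c p) \in unitmx.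
Proof.
move=> ac pc; rewrite -row_free_unit -kermx_eq0; apply/eqP/row_matrixP => i.
rewrite row0; set a := row i _.
have aG : a *m gram g c (cmap c p) = 0 by rewrite /a -row_mul mulmx_ker row0.
apply/eqP; apply: contraT => a0.
have tv0 : tvec c p a != 0.
  apply: contraNneq a0 => tv0; rewrite -(tvecK a ac pc) tv0 tcompE.
  by rewrite mul0mx.
by have := metric_pos g tv0; rewrite (metric_gram _ _ ac pc) tvecK// aG mul0mx mxE ltxx.
Qed.

Lemma gram_change c c' p : atlas M c -> atlas M c' -> cdom c p -> cdom c' p ->
  gram g c (cmap c p) = jacobian (trans c c') (cmap c p) *m gram g c' (cmap c' p) *m
    (jacobian (trans c c') (cmap c p))^T.
Proof.
move=> ac ac' pc pc'; apply: mx_bilinear_inj => a b.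
rewrite -[in LHS](tvecK a ac pc) -[in LHS](tvecK b ac pc) -(metric_gram _ _ ac pc).
rewrite (metric_gram _ _ ac' pc') !(tcomp_change _ ac ac')// !tvecK//.
by rewrite trmx_mul !mulmxA.
Qed.

Lemma gram_smooth c : atlas M c -> smooth_on (cimg c) (gram g c).
Proof.
move=> ac; apply/smooth_mxP; first exact: cimg_open (atlas_chart ac).
move=> i j; have := metric_smooth g i j ac ac; rewrite setIid.
rewrite (_ : (fun x => gram g c x i j) =
  (fun p => g p (coord_vec c p i) (coord_vec c p j)) \o cinv c)//.
by apply/funext => x; rewrite mxE.
Qed.

Lemma dfunE c (u : M -> R) p (X : tangent p) : atlas M c -> cdom c p ->
  differentiable (u \o cinv c) (cmap c p) ->
  dfun u X = 'D_(tcomp c X) (u \o cinv c) (cmap c p).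
Proof.
move=> ac pc du; have ac0 := chart_at_atlas p; have pc0 := chart_at_dom p.
set c0 := chart_at p in ac0 pc0 *.
have dt := trans_differentiable ac0 ac pc0 pc.
rewrite -(trans_cmap c ac0 pc0) in du *.
have dut := differentiable_comp dt du.
have oW := open_overlap ac0 ac.
have xW : overlap c0 c (cmap c0 p) by exact: overlap_cmap.
have E : \forall x \near cmap c0 p, ((u \o cinv c) \o trans c0 c) x = (u \o cinv c0) x.
  apply: filterS (open_near oW xW) => x /(overlapP _ _ ac0)[_ _ xc].
  by rewrite /trans/= (cmapK (atlas_chart ac)).
have du0 := near_eq_differentiable E dut.
rewrite /dfun -/c0 -[LHS](deriveE _ du0) -(near_eq_derive _ E).
rewrite [LHS](derive_chain _ dt du) (deriveE _ dt) -mul_jacobian tcompE.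
by [].
Qed.

(** The vector with these components satisfies g(Y, .) = du, so the choice made
    in the definition of the gradient is not void; it is unique because the
    Gram matrix is invertible. *)
Lemma tcomp_gradient c (u : M -> R) p : atlas M c -> cdom c p ->
  differentiable (u \o cinv c) (cmap c p) ->
  tcomp c (gradient g u p) = drow (u \o cinv c) (cmap c p) *m invmx (gram g c (cmap c p)).
Proof.
move=> ac pc du; have uG := gram_unit ac pc.
set G := gram g c (cmap c p) in uG *.
set d := drow _ _.
have gE (Y : tangent p) : (forall Z, g p Y Z = dfun u Z) <-> tcomp c Y = d *m invmx G.
  split=> [YE|YE Z].
    suff YG : tcomp c Y *m G = d by rewrite -YG mulmxK.
    apply/rowP => j; have := YE (tvec c p (delta_mx 0 j)).
    rewrite (metric_gram _ _ ac pc) (dfunE _ ac pc du) tvecK// -(drow_mul _ du).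
    by rewrite trmx_delta -!colE !mxE.
  rewrite (metric_gram _ _ ac pc) (dfunE _ ac pc du) -(drow_mul _ du) YE.
  by rewrite mulmxKV.
apply/gE; rewrite /gradient.
apply: (@xgetPex _ 0 [set Y : tangent p | forall Z : tangent p, g p Y Z = dfun u Z]).
by exists (tvec c p (d *m invmx G)); apply/gE; rewrite tvecK.
Qed.

End Metric.

Section Divergence.
Context {R : realType} {n : nat} {M : manifold R n} (g : riemannian_metric M).
Implicit Types (c : chart R n M) (p : M).

Definition vrep c (X : forall p : M, tangent p) : 'rV[R]_n -> 'rV[R]_n :=
  fun x => tcomp c (X (cinv c x)).

Lemma gram_differentiable c p : atlas M c -> cdom c p -> differentiable (gram g c) (cmap c p).
Proof.
move=> ac pc; apply: smooth_differentiable (gram_smooth g ac) _.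
by exists p.
Qed.

Lemma invmx_gram_sym c x i j : invmx (gram g c x) i j = invmx (gram g c x) j i.
Proof. by rewrite -[in LHS](gram_sym g) -trmx_inv mxE. Qed.

(** The first and the last term of the Christoffel symbol cancel in this
    contraction, by symmetry of the inverse Gram matrix. *)
Lemma christoffel_trace c p j : atlas M c -> cdom c p ->
  \sum_i christoffel g c i i j (cmap c p) =
  2^-1 * \tr (invmx (gram g c (cmap c p)) *m 'D_(delta_mx 0 j) (gram g c) (cmap c p)).
Proof.
move=> ac pc; have dG := gram_differentiable ac pc; set x := cmap c p in dG *.
rewrite /christoffel -mulr_sumr; congr (_ * _).
set P := invmx _.
pose d l i s := partial l (fun y => gram g c y i s) x.
have gs l i s : d l i s = d l s i.
  rewrite /d; congr (partial l _ x); apply/funext => y.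
  by rewrite -[in LHS](gram_sym g) mxE.
(* The two sums that are added cancel after exchanging i and s. *)
transitivity (\sum_i \sum_s P i s * d j s i).
  have -> : \sum_i \sum_s P i s * d j s i = \sum_i \sum_s P i s * d j s i
      + (\sum_i \sum_s P i s * d i s j - \sum_i \sum_s P i s * d s i j).
    rewrite [X in _ + (_ - X)]exchange_big/=.
    rewrite [X in _ + (_ - X)](_ : _ = \sum_i \sum_s P i s * d i s j); last first.
      by apply: eq_bigr => i _; apply: eq_bigr => s _; rewrite /P invmx_gram_sym.
    by rewrite subrr addr0.
  rewrite -sumrB -big_split/=; apply: eq_bigr => i _.
  rewrite -sumrB -big_split/=; apply: eq_bigr => s _.
  by rewrite -mulrBr -mulrDr [in RHS]addrCA addrA.
apply: eq_bigr => i _; rewrite mxE; apply: eq_bigr => s _.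
by rewrite /d /partial derive_mxE.
Qed.

Lemma divergence_chart_at (X : forall p : M, tangent p) p :
  differentiable (vrep (chart_at p) X) (cmap (chart_at p) p) ->
  divergence g X p = ldiv (gram g (chart_at p)) (vrep (chart_at p) X) (cmap (chart_at p) p).
Proof.
have ac := chart_at_atlas p; have pc := chart_at_dom p.
rewrite /divergence; set c := chart_at p in ac pc *; set x := cmap c p => dX.
have dG : differentiable (gram g c) x by exact: gram_differentiable.
rewrite big_split /ldiv; apply: f_equal2.
  by apply: eq_bigr => i _; exact: esym (jacobianE i i dX).
rewrite exchange_big/=.
transitivity (\sum_j vrep c X x 0 j *
    (2^-1 * \tr (invmx (gram g c x) *m 'D_(delta_mx 0 j) (gram g c) x))).
  apply: eq_bigr => j _; rewrite -mulr_suml mulrC; congr (_ * _).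
  exact: christoffel_trace.
rewrite [in RHS](derive_basis _ dG) mulmx_sumr raddf_sum mulr_sumr; apply: eq_bigr => j _.
by rewrite -scalemxAr /= [in RHS]mxtraceZ mulrCA.
Qed.

(** The chart chosen at p is related to c by [ldiv_change]. *)
Lemma divergence_chart c (X : forall p : M, tangent p) p : atlas M c -> cdom c p ->
  differentiable (vrep c X) (cmap c p) ->
  divergence g X p = ldiv (gram g c) (vrep c X) (cmap c p).
Proof.
move=> ac pc dX; have ac0 := chart_at_atlas p; have pc0 := chart_at_dom p.
have oW := open_overlap ac ac0.
have xW := overlap_cmap pc pc0.
have oW0 := open_overlap ac0 ac.
have xW0 := overlap_cmap pc0 pc.
have st := trans_smooth ac ac0.
have sJ := smooth_jacobian oW st.
have dt := trans_differentiable ac ac0 pc pc0.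
have ds := trans_differentiable ac0 ac pc0 pc.
set c0 := chart_at p in ac0 pc0 oW xW st sJ dt xW0 oW0 ds *.
have dJ := smooth_differentiable sJ xW.
have sx : trans c0 c (cmap c0 p) = cmap c p by exact: trans_cmap.
have dX0 : differentiable (vrep c0 X) (cmap c0 p).
  have d1 : differentiable (fun y => vrep c X y *m jacobian (trans c c0) y)
      (trans c0 c (cmap c0 p)) by rewrite sx; exact: differentiable_mulmx.
  apply: near_eq_differentiable (differentiable_comp ds d1).
  apply: filterS (open_near oW0 xW0) => y /(overlapP _ _ ac0)[yi yc0 yc].
  by rewrite /vrep /trans/= (cmapK (atlas_chart ac) yc) [RHS](tcomp_change _ ac ac0 yc yc0).
rewrite (divergence_chart_at dX0) -/c0; apply: esym.
rewrite -(trans_cmap c0 ac pc) in dX0 *.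
apply: ldiv_change.
- by apply: filterS (open_near oW xW) => y; exact: smooth_differentiable.
- exact: dJ.
- by move=> v w; apply: smooth_jacobian_sym oW st xW.
- exact: jacobian_trans_unit.
- by rewrite (trans_cmap c0 ac pc); exact: gram_unit.
- by rewrite (trans_cmap c0 ac pc); exact: gram_differentiable.
- exact: dX.
- exact: dX0.
- apply: filterS (open_near oW xW) => y /(overlapP _ _ ac)[yi yc yc0].
  have [_ yE] := cimgP ac yi.
  rewrite /vrep {1}/trans/= (cmapK (atlas_chart ac0) yc0).
  by rewrite [LHS](tcomp_change _ ac ac0 yc yc0) yE.
- apply: filterS (open_near oW xW) => y /(overlapP _ _ ac)[yi yc yc0].
  have [_ yE] := cimgP ac yi.
  have := gram_change g ac ac0 yc yc0; rewrite yE => ->.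
  exact: erefl.
Qed.

(** The maps w and X are coordinate expressions of u and of its gradient that
    need to be correct on W only. In a bundle chart they will be given by closed
    formulas. *)
Lemma laplacian_chart c (u : M -> R) p (W : set 'rV[R]_n) (w : 'rV[R]_n -> R)
    (X : 'rV[R]_n -> 'rV[R]_n) :
  atlas M c -> cdom c p -> open W -> W `<=` cimg c -> W (cmap c p) ->
  (forall x, W x -> u (cinv c x) = w x) ->
  (forall x, W x -> differentiable w x) ->
  (forall x, W x -> drow w x *m invmx (gram g c x) = X x) ->
  differentiable X (cmap c p) ->
  laplacian g u p = ldiv (gram g c) X (cmap c p).
Proof.
move=> ac pc oW Wc xW uw dw wX dX; rewrite /laplacian.
have E : \forall x \near cmap c p, X x = vrep c (gradient g u) x.
  apply: filterS (open_near oW xW) => x Wx.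
  have [xd xE] := cimgP ac (Wc x Wx).
  have uwx : {near x, w =1 u \o cinv c}.
    by apply: filterS (open_near oW Wx) => y Wy; rewrite /= uw.
  have du := near_eq_differentiable uwx (dw x Wx).
  rewrite /vrep (tcomp_gradient _ ac xd) ?xE// -wX//; congr (_ *m _).
  by apply/rowP => j; rewrite !mxE; exact: near_eq_derive.
rewrite (divergence_chart ac pc); last exact: near_eq_differentiable dX.
by apply: esym; exact: near_eq_ldiv.
Qed.

Lemma smooth_drow (U : set 'rV[R]_n) (w : 'rV[R]_n -> R) : open U ->
  smooth_on U w -> smooth_on U (drow w).
Proof.
move=> oU sw; apply/smooth_mxP => // i j.
rewrite (_ : (fun x => _) = 'D_(delta_mx 0 j) w); first exact: smooth_derive.
by apply/funext => x; rewrite mxE.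
Qed.

Lemma laplacian_smooth_chart c (u : M -> R) p : atlas M c -> cdom c p ->
  smooth_on (cimg c) (u \o cinv c) ->
  laplacian g u p =
    ldiv (gram g c) (fun x => drow (u \o cinv c) x *m invmx (gram g c x)) (cmap c p).
Proof.
move=> ac pc su; have oW := cimg_open (atlas_chart ac).
have xW : cimg c (cmap c p) by exists p.
apply: (laplacian_chart (W := cimg c) (w := u \o cinv c)) => //.
  by move=> x; exact: smooth_differentiable.
apply: differentiable_mulmx; first by apply: smooth_differentiable xW; exact: smooth_drow.
apply: differentiable_invmx (gram_differentiable ac pc).
apply: filterS (open_near oW xW) => x xc; have [xd xE] := cimgP ac xc.
by rewrite -xE; exact: gram_unit.
Qed.

Lemma smooth_ldiv (U : set 'rV[R]_n) (G : 'rV[R]_n -> 'M[R]_n) (X : 'rV[R]_n -> 'rV[R]_n) :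
  open U -> (forall x, U x -> G x \in unitmx) ->
  smooth_on U G -> smooth_on U X -> smooth_on U (ldiv G X).
Proof.
move=> oU uG sG sX k; have CX := (smooth_mxP X oU).1 sX.
have C : Cn k U (fun x => \sum_i jacobian X x i i + 2^-1 *
    \sum_i \sum_l invmx (G x) i l * \sum_j X x 0 j * 'D_(delta_mx 0 j) G x l i).
  apply: Cn_add => //.
    apply: Cn_sum => // i _; exact: ((smooth_mxP _ oU).1 (smooth_jacobian oU sX) i i k).
  apply: Cn_mul => //; first exact: Cn_cst.
  apply: Cn_sum => // i _; apply: Cn_sum => // l _; apply: Cn_mul => //.
    exact: ((Cn_mxP k _ oU).1 (Cn_invmx oU uG (sG k)) i l).
  apply: Cn_sum => // j _; apply: Cn_mul => //; first exact: CX.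
  exact: ((smooth_mxP _ oU).1 (smooth_derive (delta_mx 0 j) sG) l i k).
apply: Cn_ext C => // x Ux; rewrite /ldiv; apply: f_equal2; first by [].
congr (_ * _); apply: eq_bigr => i _; rewrite mxE; apply: eq_bigr => l _; congr (_ * _).
rewrite (derive_basis _ (smooth_differentiable sG Ux)) summxE.
by apply: eq_bigr => j _; rewrite mxE.
Qed.

(** Around every point the Laplacian has one expression, valid on a whole
    chart, in place of the pointwise choice of charts in its definition. *)
Lemma laplacian_smooth (u : M -> R) : smooth_fun [set: M] u ->
  smooth_fun [set: M] (laplacian g u).
Proof.
move=> su c ac; have oW := cimg_open (atlas_chart ac).
have := su c ac; rewrite setTI -/(cimg c) => suc k.
have uG x : cimg c x -> gram g c x \in unitmx.
  by move=> [p pc <-]; exact: gram_unit.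
have sG := gram_smooth g ac.
have : smooth_on (cimg c) (ldiv (gram g c)
    (fun x => drow (u \o cinv c) x *m invmx (gram g c x))).
  apply: smooth_ldiv => // l; apply: Cn_mulmx => //; first exact: smooth_drow.
  by apply: Cn_invmx => //; exact: sG.
move=> /(_ k); apply: Cn_ext => // x /(cimgP ac)[xd xE].
by rewrite /= (laplacian_smooth_chart ac xd suc) xE.
Qed.

End Divergence.

(** * Derivatives on the half-line *)

Section HalfLine.
Context {R : realType}.
Implicit Types phi : R -> R.

(** Below 0 the function is replaced by its tangent line at 0, which turns the
    one-sided derivative at 0 into a two-sided one. *)
Definition half_line_extension phi : R -> R :=
  fun t => if 0 <= t then phi t else phi 0 + deriv_Rplus phi 0 * t.

Lemma half_line_extensionE phi t : 0 <= t -> half_line_extension phi t = phi t.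
Proof. by rewrite /half_line_extension => ->. Qed.

Lemma is_derive_half_line_extension phi r : 0 <= r ->
  cvg (quot_Rplus phi r t @[t --> filter_Rplus r]) ->
  is_derive r 1 (half_line_extension phi) (deriv_Rplus phi r).
Proof.
move=> r0; rewrite -/(deriv_Rplus phi r) => cq.
have cql : quot_Rplus phi r t @[t --> filter_Rplus r] --> deriv_Rplus phi r := cq.
suff cE : (fun h => h^-1 *: ((half_line_extension phi \o shift r) (h *: 1)
    - half_line_extension phi r)) @ 0^' --> deriv_Rplus phi r.
  by apply: DeriveDef; [apply/cvg_ex; exists (deriv_Rplus phi r)|exact: cvg_lim cE].
apply/cvgrPdist_le => e e0.
have : \forall t \near r, t != r -> 0 <= t -> `|deriv_Rplus phi r - quot_Rplus phi r t| <= e.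
  have ff : Filter (filter_Rplus r) by exact: within_filter.
  exact: ((cvgrPdist_le (FF := ff) _ _).1 cql e e0).
rewrite (near_shift 0) subr0 => near0.
(* The extension is evaluated below 0 only in the case r = 0, where its
   difference quotient is constant. *)
have posr : \forall h \near (0 : R), h + r < 0 -> r = 0.
  have [r00|r_gt0] := leP r 0; first by near=> h; rewrite (le_anti (introT andP (conj r00 r0))).
  near=> h => hr; exfalso; suff : 0 < h + r by rewrite ltNge (ltW hr).
  rewrite -ltrBlDr sub0r; near: h; apply: lt_nbhsr; by rewrite oppr_lt0.
rewrite near_withinE; near=> h => /= h0.
rewrite (half_line_extensionE _ r0) [h *: 1]mulr1.
have [hr|hr] := leP 0 (h + r); last first.
  have rE : r = 0 by move: hr; near: h.
  have -> : half_line_extension phi (h + r) = phi r + deriv_Rplus phi r * h.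
    by rewrite /half_line_extension leNgt hr rE addr0.
  rewrite addrAC subrr add0r [_ *: _]mulrC mulfK ?subrr ?normr0 ?ltW//.
rewrite half_line_extensionE//.
have : h + r != r -> 0 <= h + r ->
    `|deriv_Rplus phi r - quot_Rplus phi r (h + r)| <= e by near: h; exact: near0.
have -> : h + r != r by rewrite -subr_eq0 addrK.
by move=> /(_ isT hr); rewrite /quot_Rplus addrK [_ *: _]mulrC.
Unshelve. all: by end_near. Qed.

Lemma filter_Rplus_proper (r : R) : 0 <= r -> ProperFilter (filter_Rplus r).
Proof.
move=> r0; have ff : Filter (filter_Rplus r) by exact: within_filter.
split => // A0.
have : \forall t \near r^'+, (set0 : set R) t.
  have A0' : nbhs r [set t : R | t != r -> 0 <= t -> False] := A0.
  rewrite near_withinE; apply: (@filterS _ (nbhs r) _ _ _ _ A0') => t tA rt.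
  by apply: tA; [rewrite gt_eqF|exact: le_trans r0 (ltW rt)].
by apply: (@filter_not_empty _ (r^'+)); exact: at_right_proper_filter.
Qed.

Lemma deriv_RplusD phi psi r : 0 <= r ->
  cvg (quot_Rplus phi r t @[t --> filter_Rplus r]) ->
  cvg (quot_Rplus psi r t @[t --> filter_Rplus r]) ->
  deriv_Rplus (fun t => phi t + psi t) r = deriv_Rplus phi r + deriv_Rplus psi r.
Proof.
move=> r0 c1 c2; have pf := filter_Rplus_proper r0.
rewrite {1}/deriv_Rplus; apply: cvg_lim => //.
rewrite (_ : quot_Rplus _ r = fun t => quot_Rplus phi r t + quot_Rplus psi r t).
  exact: cvgD c1 c2.
apply/funext => t; rewrite /quot_Rplus -mulrDl; congr (_ / _).
by rewrite opprD addrACA.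
Qed.

End HalfLine.

(** * Restricted charts and differentials of maps *)

Section Restriction.
Context {R : realType} {n : nat} {M : manifold R n}.

Definition chart_restrict (c : chart R n M) (U : set M) : chart R n M :=
  Chart (cdom c `&` U) (cmap c) (cinv c).

Lemma cimg_chart_restrict (c : chart R n M) (U : set M) : atlas M c ->
  cimg (chart_restrict c U) = cimg c `&` cinv c @^-1` U.
Proof.
move=> ac; apply/seteqP; split=> x.
  move=> [p [pc pU] <-]; split; first by exists p.
  by rewrite /= (cmapK (atlas_chart ac)).
move=> [xc xU]; have [xd xE] := cimgP ac xc.
by exists (cinv c x).
Qed.

(** The restriction has smooth transitions with every chart of the atlas, which
    is maximal. *)
Lemma chart_restrict_atlas (c : chart R n M) (U : set M) : atlas M c -> open U ->
  atlas M (chart_restrict c U).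
Proof.
move=> ac oU; have cc := atlas_chart ac.
apply: atlas_max => [|c' ac'].
  split.
  - by apply: openI => //; exact: cdom_open cc.
  - by rewrite cimg_chart_restrict//; exact: open_cinv_preimage.
  - by move=> p [pc _]; exact: cmapK cc _ pc.
  - by move=> p [pc _]; exact: cmap_cont cc _ pc.
  - by rewrite cimg_chart_restrict// => x [xc _]; exact: cinv_cont cc _ xc.
split=> l.
- apply: Cn_sub (atlas_smooth ac ac' l) => _ [p [[pc _] pc'] <-].
  by exists p.
- apply: Cn_sub (atlas_smooth ac' ac l) => _ [p [pc' [pc _]] <-].
  by exists p.
Qed.

End Restriction.

Lemma tcomp_dmap {R : realType} {n k : nat} {M : manifold R n} {N : manifold R k}
    (F : M -> N) (c : chart R n M) (c' : chart R k N) (p : M) (X : tangent p) :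
  atlas M c -> cdom c p -> atlas N c' -> cdom c' (F p) ->
  {for p, continuous F} ->
  differentiable (cmap c' \o F \o cinv c) (cmap c p) ->
  tcomp c' (dmap F X) = tcomp c X *m jacobian (cmap c' \o F \o cinv c) (cmap c p).
Proof.
move=> ac pc ac' pc' cF df.
have ac0 := chart_at_atlas p; have pc0 := chart_at_dom p.
have ac0' := chart_at_atlas (F p); have pc0' := chart_at_dom (F p).
rewrite tcompE /dmap.
set c0 := chart_at p in ac0 pc0 *; set c0' := chart_at (F p) in ac0' pc0' *.
set f := cmap c' \o F \o cinv c in df *.
have fx : f (cmap c p) = cmap c' (F p) by rewrite /f/= (cmapK (atlas_chart ac) pc).
have dt := trans_differentiable ac0 ac pc0 pc.
have tx := trans_cmap c ac0 pc0.
have dt' := trans_differentiable ac' ac0' pc' pc0'.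
have dft : differentiable (f \o trans c0 c) (cmap c0 p).
  by apply: differentiable_comp dt _; rewrite tx.
have dtft : differentiable (trans c' c0') ((f \o trans c0 c) (cmap c0 p)).
  by rewrite /= tx fx.
have d0 := differentiable_comp dft dtft.
have E : {near cmap c0 p, trans c' c0' \o (f \o trans c0 c) =1
    cmap c0' \o F \o cinv c0}.
  have cFc : {for cmap c0 p, continuous (F \o cinv c0)}.
    apply: continuous_comp; first by apply: (cinv_cont (atlas_chart ac0)); exists p.
    by rewrite (cmapK (atlas_chart ac0) pc0).
  have nF : \forall x \near cmap c0 p, cdom c' (F (cinv c0 x)).
    apply: cFc; rewrite /= (cmapK (atlas_chart ac0) pc0); apply: open_nbhs_nbhs; split=> //.
    exact: cdom_open (atlas_chart ac').
  have := open_near (open_overlap ac0 ac) (overlap_cmap pc0 pc).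
  apply: filterS2 nF => x xF /(overlapP _ _ ac0)[_ _ xc].
  rewrite /trans/f/= (cmapK (atlas_chart ac) xc).
  by rewrite (cmapK (atlas_chart ac') xF).
have Jf : 'd (cmap c0' \o F \o cinv c0) (cmap c0 p) X =
    X *m (jacobian (trans c0 c) (cmap c0 p) *m jacobian f (cmap c p) *m
      jacobian (trans c' c0') (cmap c' (F p))).
  rewrite -mul_jacobian -(near_eq_jacobian E d0); congr (_ *m _).
  rewrite [LHS](jacobian_chain dft dtft) [in LHS](jacobian_chain dt); last by rewrite tx.
  by rewrite /= tx fx.
rewrite Jf -!mulmxA (jacobian_trans ac' ac0' ac' pc' pc0' pc').
by rewrite (jacobian_transxx ac' pc') mulmx1 mulmxA -tcompE.
Qed.

(** * Bundle charts *)

(** A local trivialization over the domain of one chart of M, together with the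
    fact that it induces a chart of the total space. *)
Record trivialization {R : realType} {m k : nat} {M : manifold R m}
    (E : vector_bundle k M) := Trivialization {
  tchart : chart R m M;
  tcoord : total_space E -> 'rV[R]_k;
  tcoordinv : forall q : M, 'rV[R]_k -> fib E q;
  tchart_atlas : atlas M tchart;
  tcoord_linear : forall q, cdom tchart q ->
    linear (fun v : fib E q => tcoord (pt E v));
  tcoordK : forall q, cdom tchart q ->
    cancel (fun v : fib E q => tcoord (pt E v)) (tcoordinv q);
  tcoordinvK : forall q, cdom tchart q ->
    cancel (tcoordinv q) (fun v : fib E q => tcoord (pt E v));
  tbundle_atlas : atlas (total_space E)
    (bundle_chart (bproj E) (@pt _ _ _ _ E) tchart tcoord tcoordinv)
}.

Section Trivialization.
Context {R : realType} {m k : nat} {M : manifold R m} {E : vector_bundle k M}.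

Lemma exists_trivialization (p : M) :
  exists T : trivialization E, cdom (tchart T) p.
Proof.
have [U [tr [trinv [[oU Up] tU aU]]]] := loc_triv E p.
have ac := chart_restrict_atlas (chart_at_atlas p) oU.
have cU : cdom (chart_restrict (chart_at p) U) `<=` U by move=> q [].
exists (@Trivialization _ _ _ _ E _ tr trinv ac
  (fun q qc => let: And3 l _ _ := tU q (cU q qc) in l)
  (fun q qc => let: And3 _ l _ := tU q (cU q qc) in l)
  (fun q qc => let: And3 _ _ l := tU q (cU q qc) in l) (aU _ ac cU)).
by split=> //; exact: chart_at_dom.
Qed.

Variable T : trivialization E.
Let c := tchart T.
Let ac : atlas M c := tchart_atlas T.

Definition tbundle : chart R (m + k) (total_space E) :=
  bundle_chart (bproj E) (@pt _ _ _ _ E) (tchart T) (@tcoord _ _ _ _ _ T) (tcoordinv T).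
Let C := tbundle.
Let aC : atlas (total_space E) C := tbundle_atlas T.

Lemma tcoordZ q (a : R) (v : fib E q) : cdom c q ->
  tcoord T (pt E (a *: v)) = a *: tcoord T (pt E v).
Proof.
move=> qc; have lin := tcoord_linear qc.
have t0 : tcoord T (pt E (0 : fib E q)) = 0.
  by have := lin (-1) 0 0; rewrite scaleN1r oppr0 addr0 scaleN1r addNr.
by have := lin a v 0; rewrite addr0 t0 addr0.
Qed.

Lemma tcoordD q (v w : fib E q) : cdom c q ->
  tcoord T (pt E (v + w)) = tcoord T (pt E v) + tcoord T (pt E w).
Proof. by move=> qc; have := tcoord_linear qc 1 v w; rewrite !scale1r. Qed.

Lemma tcoord_sum q (I : Type) (r : seq I) (F : I -> fib E q) : cdom c q ->
  tcoord T (pt E (\sum_(i <- r) F i)) = \sum_(i <- r) tcoord T (pt E (F i)).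
Proof.
move=> qc; elim: r => [|i r IH]; last by rewrite !big_cons tcoordD// IH.
by rewrite !big_nil -(scale0r (0 : fib E q)) tcoordZ// scale0r.
Qed.

(** The section with constant coordinates y. It is linear in y over all of M,
    whereas [tcoordinv q] is known to be linear only over the domain of the
    chart; so a covariant derivative of it expands over the basic sections. *)
Definition frame (y : 'rV[R]_k) : section E :=
  fun q => \sum_a y 0 a *: tcoordinv T q (delta_mx 0 a).

Lemma tcoord_frame y q : cdom c q -> tcoord T (pt E (frame y q)) = y.
Proof.
move=> qc; rewrite /frame tcoord_sum// [RHS]row_sum_delta; apply: eq_bigr => a _.
by rewrite tcoordZ// tcoordinvK.
Qed.

Lemma frame_tcoord q (v : fib E q) : cdom c q -> frame (tcoord T (pt E v)) q = v.
Proof. by move=> qc; apply: (can_inj (tcoordK qc)); rewrite tcoord_frame. Qed.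

Lemma tbundle_dom q (v : fib E q) : cdom c q -> cdom C (pt E v).
Proof. by rewrite /C/= bproj_pt. Qed.

Lemma tbundle_pt q (v : fib E q) :
  cmap C (pt E v) = row_mx (cmap c q) (tcoord T (pt E v)).
Proof. by rewrite /C/= bproj_pt. Qed.

Lemma tbundle_frame y q : cdom c q -> cmap C (pt E (frame y q)) = row_mx (cmap c q) y.
Proof. by move=> qc; rewrite tbundle_pt tcoord_frame. Qed.

Lemma tbundle_inv y q : cdom c q -> cinv C (row_mx (cmap c q) y) = pt E (frame y q).
Proof.
by move=> qc; rewrite -(tbundle_frame y qc) (cmapK (atlas_chart aC))//; exact: tbundle_dom.
Qed.

Lemma tbundle_invE z : cimg c (lsubmx z) ->
  cinv C z = pt E (frame (rsubmx z) (cinv c (lsubmx z))).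
Proof.
move=> zc; have [qd qE] := cimgP ac zc.
by rewrite -{1}(hsubmxK z) -{1}qE tbundle_inv.
Qed.

Lemma tbundle_img z : cimg C z <-> cimg c (lsubmx z).
Proof.
split=> [[e ec <-]|zc]; first by rewrite row_mxKl; exists (bproj E e).
have [qd qE] := cimgP ac zc.
exists (pt E (frame (rsubmx z) (cinv c (lsubmx z)))); first exact: tbundle_dom.
by rewrite tbundle_frame// qE hsubmxK.
Qed.

Lemma smooth_row_mx (U : set 'rV[R]_m) (f : 'rV[R]_m -> 'rV[R]_m) (y : 'rV[R]_k) :
  open U -> smooth_on U f -> smooth_on U (fun x => row_mx (f x) y).
Proof.
move=> oU /(smooth_mxP _ oU) sf; apply/smooth_mxP => // i j.
case: (split_ordP j) => l -> l0.
  by under eq_fun do rewrite row_mxEl; exact: (sf i l l0).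
by under eq_fun do rewrite row_mxEr; exact: (Cn_cst l0 U (y i l)).
Qed.

Lemma constant_section_continuous (s : section E) (y : 'rV[R]_k) :
  (forall q, cdom c q -> tcoord T (pt E (s q)) = y) ->
  forall q, cdom c q -> {for q, continuous (fun q => pt E (s q))}.
Proof.
move=> sy q qc.
have sE q' : cdom c q' -> pt E (s q') = cinv C (row_mx (cmap c q') y).
  by move=> qc'; rewrite tbundle_inv// -(sy q' qc') frame_tcoord.
have cont : {for q, continuous (cinv C \o (fun x => row_mx x y) \o cmap c)}.
  apply: continuous_comp; first exact: cmap_cont (atlas_chart ac) _ qc.
  apply: continuous_comp.
    have C0 : Cn 0 setT (fun x : 'rV[R]_m => row_mx x y).
      apply: smooth_row_mx; first exact: openT.
      by move=> l; exact: (@Cn_linear _ _ _ l setT idfun (fun x => @cvg_id _ _)).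
    exact: C0.
  apply: (cinv_cont (atlas_chart aC)); apply/tbundle_img; rewrite row_mxKl.
  by exists q.
have nE : \forall q' \near q, (cinv C \o (fun x => row_mx x y) \o cmap c) q' = pt E (s q').
  by apply: filterS (open_near (cdom_open (atlas_chart ac)) qc) => q' qc'; rewrite sE.
have cont' : (cinv C \o (fun x => row_mx x y) \o cmap c) @ q --> pt E (s q).
  by rewrite sE//; exact: cont.
exact: cvg_trans (near_eq_cvg nE) cont'.
Qed.

(** In the chart induced by the trivialization such a section is
    x |-> (x, y). *)
Lemma constant_section_smooth (s : section E) (y : 'rV[R]_k) :
  (forall q, cdom c q -> tcoord T (pt E (s q)) = y) -> smooth_section (cdom c) s.
Proof.
move=> sy; have cs := constant_section_continuous sy.
have sE q' : cdom c q' -> pt E (s q') = cinv C (row_mx (cmap c q') y).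
  by move=> qc'; rewrite tbundle_inv// -(sy q' qc') frame_tcoord.
split=> // c0 c' ac0 ac'; set F := fun p => pt E (s p).
have WE : cmap c0 @` (cdom c `&` cdom c0 `&` F @^-1` cdom c') =
    cimg c0 `&` cinv c0 @^-1` (cdom c `&` F @^-1` cdom c').
  apply/seteqP; split=> x.
    move=> [p [[pc pc0] pF] <-]; split; first by exists p.
    by rewrite /= (cmapK (atlas_chart ac0)).
  move=> [xc [xd xF]]; have [xd0 xE] := cimgP ac0 xc.
  by exists (cinv c0 x).
have oV : open (cdom c `&` F @^-1` cdom c').
  rewrite openE => q [qc qF]; apply: filterI.
    exact: (open_near (cdom_open (atlas_chart ac)) qc).
  by apply: (cs q qc); exact: (open_near (cdom_open (atlas_chart ac')) qF).
have oW := open_cinv_preimage ac0 oV.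
rewrite WE; apply/smooth_mxP => // i j l.
have sr : smooth_on (cimg c0 `&` cinv c0 @^-1` (cdom c `&` F @^-1` cdom c'))
    (fun x => row_mx (trans c0 c x) y).
  apply: smooth_row_mx => // l'; apply: Cn_sub (trans_smooth ac0 ac l') => x [xc [xd _]].
  by apply/(overlapP _ _ ac0); have [] := cimgP ac0 xc.
have oCc' := open_overlap aC ac'.
have st := (smooth_mxP _ oCc').1 (trans_smooth aC ac') i j l.
apply: Cn_ext (Cn_comp (U' := overlap C c') oW _ (sr l) st) => // x [xc [xd xF]].
  by rewrite [in RHS]/comp /F (sE _ xd).
apply/(overlapP _ _ aC); rewrite -[cinv C _](sE _ xd).
split; [|exact: tbundle_dom|exact: xF].
by apply/tbundle_img; rewrite row_mxKl; exists (cinv c0 x).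
Qed.

End Trivialization.

(** * Connection and fibre metric in a trivialization *)

Section Frame.
Context {R : realType} {m k : nat} {M : manifold R m} {E : vector_bundle k M}.
Variables (T : trivialization E) (h : fiber_metric E) (D : connection E).
Let c := tchart T.
Let ac : atlas M c := tchart_atlas T.

Definition conn_mx (i : 'I_m) (x : 'rV[R]_m) : 'M[R]_k :=
  \matrix_a tcoord T (pt E (cov D (coord_vec c (cinv c x) i) (frame T (delta_mx 0 a)))).

Definition fib_gram (x : 'rV[R]_m) : 'M[R]_k :=
  \matrix_(a, b) fmetric h (frame T (delta_mx 0 a) (cinv c x))
                           (frame T (delta_mx 0 b) (cinv c x)).

Lemma constant_section_near (s : section E) (y : 'rV[R]_k) q :
  (forall q, cdom c q -> tcoord T (pt E (s q)) = y) -> cdom c q ->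
  smooth_section_near q s.
Proof.
move=> sy qc; exists (cdom c); last exact: constant_section_smooth sy.
by split=> //; exact: cdom_open (atlas_chart ac).
Qed.

Lemma frame_near (y : 'rV[R]_k) q : cdom c q -> smooth_section_near q (frame T y).
Proof. by apply: constant_section_near => q' qc'; exact: tcoord_frame. Qed.

Lemma dfun_cst (a : R) (q : M) (X : tangent q) : dfun (fun _ : M => a) X = 0.
Proof.
rewrite /dfun; set u := (X in 'd X _).
by rewrite (_ : u = cst a)// (diff_cst a (cmap (chart_at q) q)).
Qed.

Lemma cov_scale q (X : tangent q) (a : R) (s : section E) :
  smooth_section_near q s -> cov D X (fun q => a *: s q) = a *: cov D X s.
Proof.
move=> ss; rewrite (cov_leibniz D X (u := fun _ => a) _ ss); last first.
  exists [set: M]; first by split=> //; exact: openT.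
  by move=> c' _ l; exact: (Cn_cst l _ a).
by rewrite dfun_cst scale0r add0r.
Qed.

Lemma cov_sum_dir q (s : section E) (I : Type) (r : seq I) (a : I -> R)
    (X : I -> tangent q) : smooth_section_near q s ->
  cov D (\sum_(i <- r) a i *: X i) s = \sum_(i <- r) a i *: cov D (X i) s.
Proof.
move=> ss; have lin := cov_linear D ss.
elim: r => [|i r IH]; last by rewrite !big_cons -IH; exact: lin.
rewrite !big_nil; have := lin (-1) 0 0.
by rewrite scaleN1r oppr0 addr0 scaleN1r addNr.
Qed.

Lemma frame_sum y : frame T y = fun q => \sum_a y 0 a *: frame T (delta_mx 0 a) q.
Proof.
apply: functional_extensionality_dep => q; rewrite {1}/frame; apply: eq_bigr => a _.
congr (_ *: _); rewrite /frame (bigD1 a)//= big1 => [|b ba].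
  by rewrite mxE !eqxx scale1r addr0.
by rewrite mxE eqxx (negbTE ba) scale0r.
Qed.

Lemma cov_frame q (X : tangent q) y : cdom c q ->
  cov D X (frame T y) = \sum_a y 0 a *: cov D X (frame T (delta_mx 0 a)).
Proof.
move=> qc; rewrite frame_sum.
elim: (index_enum _) => [|a r IH].
  rewrite big_nil (_ : (fun _ => _) = (fun q => (0 : R) *: (0 : fib E q))); last first.
    by apply: functional_extensionality_dep => q'; rewrite big_nil scale0r.
  rewrite (cov_scale X 0 (s := fun q => 0)) ?scale0r//.
  apply: (@constant_section_near _ 0) => // q' qc'.
  by rewrite -(scale0r (0 : fib E q')) tcoordZ// scale0r.
rewrite big_cons -IH -cov_scale; last exact: frame_near.
rewrite -cov_add.
- by congr (cov D X _); apply: functional_extensionality_dep => q'; rewrite big_cons.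
- apply: (@constant_section_near _ (y 0 a *: delta_mx 0 a)) => // q' qc'.
  by rewrite tcoordZ// tcoord_frame.
- apply: (@constant_section_near _ (\sum_(i <- r) y 0 i *: delta_mx 0 i)) => // q' qc'.
  rewrite tcoord_sum//; apply: eq_bigr => b _.
  by rewrite tcoordZ// tcoord_frame.
Qed.

Lemma cov_frame_coord q (X : tangent q) y : cdom c q ->
  tcoord T (pt E (cov D X (frame T y))) =
  \sum_i tcomp c X 0 i *: (y *m conn_mx i (cmap c q)).
Proof.
move=> qc; rewrite -{1}(tcompK X ac qc) tvec_sum cov_sum_dir; last exact: frame_near.
rewrite tcoord_sum//; apply: eq_bigr => i _; rewrite tcoordZ//; congr (_ *: _).
rewrite cov_frame// tcoord_sum// mulmx_sum_row; apply: eq_bigr => a _.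
by rewrite tcoordZ// rowK (cmapK (atlas_chart ac)).
Qed.

Lemma fmetric_suml q (I : Type) (r : seq I) (a : I -> R) (v : I -> fib E q) (w : fib E q) :
  fmetric h (\sum_(i <- r) a i *: v i) w = \sum_(i <- r) a i * fmetric h (v i) w.
Proof.
have lin := fmetric_linear h w.
elim: r => [|i r IH]; last by rewrite !big_cons -IH; exact: lin.
rewrite !big_nil; have := lin (-1) 0 0.
by rewrite scaleN1r oppr0 addr0 mulN1r addNr.
Qed.

Lemma fmetric_sumr q (I : Type) (r : seq I) (a : I -> R) (v : I -> fib E q) (w : fib E q) :
  fmetric h w (\sum_(i <- r) a i *: v i) = \sum_(i <- r) a i * fmetric h w (v i).
Proof.
by rewrite fmetric_sym fmetric_suml; apply: eq_bigr => i _; rewrite (fmetric_sym h (v i)).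
Qed.

Lemma fmetric_frame q (y y' : 'rV[R]_k) : cdom c q ->
  fmetric h (frame T y q) (frame T y' q) = (y *m fib_gram (cmap c q) *m y'^T) 0 0.
Proof.
move=> qc; rewrite (frame_sum y) (frame_sum y') fmetric_suml.
under eq_bigr do rewrite fmetric_sumr.
rewrite mxE; under [RHS]eq_bigr do rewrite !mxE mulr_suml.
rewrite exchange_big/=; apply: eq_bigr => i _; rewrite mulr_sumr; apply: eq_bigr => j _.
by rewrite !mxE (cmapK (atlas_chart ac) qc) mulrAC mulrA.
Qed.

Lemma fmetric_tcoord q (v w : fib E q) : cdom c q ->
  fmetric h v w = (tcoord T (pt E v) *m fib_gram (cmap c q) *m (tcoord T (pt E w))^T) 0 0.
Proof. by move=> qc; rewrite -fmetric_frame// !frame_tcoord. Qed.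

Lemma fib_gram_sym x : (fib_gram x)^T = fib_gram x.
Proof. by apply/matrixP => a b; rewrite !mxE fmetric_sym. Qed.

Lemma fib_gram_unit q : cdom c q -> fib_gram (cmap c q) \in unitmx.
Proof.
move=> qc; rewrite -row_free_unit -kermx_eq0; apply/eqP/row_matrixP => i.
rewrite row0; set a := row i _.
have aG : a *m fib_gram (cmap c q) = 0 by rewrite /a -row_mul mulmx_ker row0.
apply/eqP; apply: contraT => a0.
have fa0 : frame T a q != 0.
  apply: contraNneq a0 => fa0; rewrite -(tcoord_frame a qc) fa0.
  by rewrite -(scale0r (0 : fib E q)) tcoordZ// scale0r.
by have := fmetric_pos h fa0; rewrite fmetric_frame// aG mul0mx mxE ltxx.
Qed.

Lemma fib_gram_smooth : smooth_on (cimg c) fib_gram.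
Proof.
apply/smooth_mxP; first exact: cimg_open (atlas_chart ac).
move=> a b; have oc := cdom_open (atlas_chart ac).
have sf y : smooth_section (cdom c) (frame T y).
  by apply: (@constant_section_smooth _ _ _ _ _ T _ y) => q; exact: tcoord_frame.
have := fmetric_smooth h oc (sf (delta_mx 0 a)) (sf (delta_mx 0 b)) ac; rewrite setIid.
rewrite (_ : (fun x => fib_gram x a b) = (fun q => fmetric h (frame T (delta_mx 0 a) q)
  (frame T (delta_mx 0 b) q)) \o cinv c)//.
by apply/funext => x; rewrite mxE.
Qed.

(** The compatibility of D with h, read on pairs of basic sections. *)
Lemma derive_fib_gram (hD : compatible D h) q i : cdom c q ->
  'D_(delta_mx 0 i) fib_gram (cmap c q) =
    conn_mx i (cmap c q) *m fib_gram (cmap c q) +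
    fib_gram (cmap c q) *m (conn_mx i (cmap c q))^T.
Proof.
move=> qc; have xc : cimg c (cmap c q) by exists q.
have dH := smooth_differentiable fib_gram_smooth xc.
apply/matrixP => a b; rewrite (derive_mxE _ _ _ dH).
set u := fun q => fmetric h (frame T (delta_mx 0 a) q) (frame T (delta_mx 0 b) q).
have uE : (fun x => fib_gram x a b) = u \o cinv c by apply/funext => x; rewrite mxE.
have du := (differentiable_mxP _ _).1 dH a b; rewrite uE in du *.
have tX : tcomp c (coord_vec c q i) = delta_mx 0 i by rewrite coord_vecE tvecK.
have := hD q (coord_vec c q i) _ _ (frame_near (delta_mx 0 a) qc) (frame_near (delta_mx 0 b) qc).
rewrite -/u [in LHS](dfunE _ ac qc du) tX => ->.
have covE y : tcoord T (pt E (cov D (coord_vec c q i) (frame T y))) = y *m conn_mx i (cmap c q).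
  rewrite cov_frame_coord// tX (bigD1 i)//= big1 => [|j ji].
    by rewrite mxE !eqxx scale1r addr0.
  by rewrite mxE eqxx (negbTE ji) scale0r.
rewrite !fmetric_tcoord// !covE !tcoord_frame// [RHS]mxE; congr (_ + _).
  by rewrite -(mulmxA _ (conn_mx i _)) -rowE trmx_delta -colE !mxE.
by rewrite trmx_mul mulmxA -(mulmxA _ (fib_gram _)) -rowE trmx_delta -colE !mxE.
Qed.

End Frame.

(** * The metric of the total space in a bundle chart *)

Section Shear.
Context {R : realType} {m k : nat}.
Implicit Types (Q : 'M[R]_(m, k)) (A : 'M[R]_m) (B : 'M[R]_k).

Definition shear Q : 'M[R]_(m + k) := block_mx 1%:M Q 0 1%:M.

Lemma shearK Q Q' : shear Q *m shear Q' = shear (Q + Q').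
Proof.
by rewrite /shear mulmx_block !mulmx1 !mul1mx !mulmx0 !mul0mx !addr0 !add0r addrC.
Qed.

Lemma shear0 : shear 0 = 1%:M.
Proof. by rewrite /shear -scalar_mx_block. Qed.

Lemma shear_unit Q : shear Q \in unitmx.
Proof. by have /mulmx1_unit[] : shear Q *m shear (- Q) = 1%:M by rewrite shearK subrr shear0. Qed.

Lemma invmx_shear Q : invmx (shear Q) = shear (- Q).
Proof.
by rewrite -[RHS](mulKmx (shear_unit Q)) shearK subrr shear0 mulmx1.
Qed.

Lemma mxtrace_scale n (a a' : R) (M M' : 'M[R]_n) : a != 0 -> M \in unitmx ->
  \tr (invmx (a *: M) *m (a' *: M + a *: M')) = n%:R * (a' / a) + \tr (invmx M *m M').
Proof.
move=> a0 uM; rewrite invmxZ; last by rewrite unitmxZ ?unitfE.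
rewrite mulmxDr -!scalemxAl -!scalemxAr !scalerA mulVf// scale1r mulVmx//.
by rewrite mxtraceD mxtraceZ mxtrace1 mulrC [_ * a']mulrC.
Qed.

End Shear.

(** When A gives the connection coefficients, row i holds the fibre coordinates
    of the image of the i-th base coordinate vector under the connection map. *)
Definition vert_mx {R : realType} {m k : nat} (A : 'I_m -> 'rV[R]_m -> 'M[R]_k)
    (z : 'rV[R]_(m + k)) : 'M[R]_(m, k) :=
  \matrix_i (rsubmx z *m A i (lsubmx z)).

(** The function r = h(e, e), when H is the Gram matrix of h. *)
Definition fib_sqnorm {R : realType} {m k : nat} (H : 'rV[R]_m -> 'M[R]_k)
    (z : 'rV[R]_(m + k)) : R :=
  (rsubmx z *m H (lsubmx z) *m (rsubmx z)^T) 0 0.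

Lemma shear_quadratic {R : realType} {m k : nat} (a1 b1 : 'rV[R]_m) (a2 b2 : 'rV[R]_k)
    (Q : 'M[R]_(m, k)) (A : 'M[R]_m) (B : 'M[R]_k) :
  (row_mx a1 a2 *m (shear Q *m block_mx A 0 0 B *m (shear Q)^T) *m (row_mx b1 b2)^T) 0 0 =
  (a1 *m A *m b1^T) 0 0 + ((a1 *m Q + a2) *m B *m (b1 *m Q + b2)^T) 0 0.
Proof.
have shearE (u1 : 'rV[R]_m) (u2 : 'rV[R]_k) :
    row_mx u1 u2 *m shear Q = row_mx u1 (u1 *m Q + u2).
  by rewrite mul_row_block !mulmx1 mulmx0 addr0.
rewrite !mulmxA shearE -mulmxA -trmx_mul shearE mul_row_block !mulmx0 addr0 add0r.
by rewrite tr_row_mx mul_row_col mxE.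
Qed.

Section TotalMetric.
Context {R : realType} {m k : nat} {M : manifold R m} {E : vector_bundle k M}.
Variables (T : trivialization E) (h : fiber_metric E) (D : connection E).
Variable K : connection_map D.
Let c := tchart T.
Let ac : atlas M c := tchart_atlas T.
Let C := tbundle T.
Let aC : atlas (total_space E) C := tbundle_atlas T.

Lemma bproj_continuous q (v : fib E q) : cdom c q -> {for pt E v, continuous (bproj E)}.
Proof.
move=> qc; have ve := tbundle_dom v qc.
have cont : {for pt E v, continuous (cinv c \o lsubmx \o cmap C)}.
  apply: continuous_comp; first exact: cmap_cont (atlas_chart aC) _ ve.
  apply: continuous_comp; first exact: continuous_lsubmx.
  apply: (cinv_cont (atlas_chart ac)); rewrite tbundle_pt row_mxKl.
  by exists q.
have bE e : cdom C e -> (cinv c \o lsubmx \o cmap C) e = bproj E e.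
  by move=> ec; rewrite /= row_mxKl (cmapK (atlas_chart ac)).
have nE : \forall e \near pt E v, (cinv c \o lsubmx \o cmap C) e = bproj E e.
  by apply: filterS (open_near (cdom_open (atlas_chart aC)) ve) => e; exact: bE.
have cont' : (cinv c \o lsubmx \o cmap C) @ pt E v --> bproj E (pt E v).
  by rewrite -(bE _ ve); exact: cont.
exact: cvg_trans (near_eq_cvg nE) cont'.
Qed.

Lemma row_mx_left_is_diff (y : 'rV[R]_k) (x u : 'rV[R]_m) :
  differentiable (fun x => row_mx x y) x /\
  u *m jacobian (fun x : 'rV[R]_m => row_mx x y) x = row_mx u 0.
Proof.
(* The map is affine with linear part x |-> x *m B. *)
pose B : 'M[R]_(m, m + k) := row_mx 1%:M 0.
have fE : (fun x : 'rV[R]_m => row_mx x y) = (fun x => x *m B + row_mx 0 y).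
  by apply/funext => x'; rewrite mul_mx_row mulmx1 mulmx0 add_row_mx addr0 add0r.
have d1 : differentiable (fun x : 'rV[R]_m => x *m B) x.
  by apply: differentiable_mulmx; [exact: ex_diff|exact: differentiable_cst].
have d2 : differentiable (fun _ : 'rV[R]_m => row_mx (0 : 'rV[R]_m) y) x.
  exact: differentiable_cst.
have df : differentiable (fun x : 'rV[R]_m => row_mx x y) x.
  by rewrite fE; exact: differentiable_add.
split=> //; rewrite -(deriveEjacobian _ df) fE.
rewrite [LHS](@deriveD _ _ _ (fun x => x *m B) (fun=> row_mx 0 y));
  [|exact: diff_derivable|exact: diff_derivable].
rewrite derive_cst addr0 derive_mulmx; [|exact: ex_diff|exact: differentiable_cst].
by rewrite derive_id derive_cst mulmx0 addr0 mul_mx_row mulmx1 mulmx0.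
Qed.

Lemma tcomp_dmap_bproj q (v : fib E q) (Z : tangent (pt E v)) : cdom c q ->
  tcomp c (dmap (bproj E) Z) = lsubmx (tcomp C Z).
Proof.
move=> qc; have ve := tbundle_dom v qc.
have zC : cimg C (cmap C (pt E v)) by exists (pt E v).
have E1 : {near cmap C (pt E v), (lsubmx : 'rV[R]_(m + k) -> 'rV[R]_m) =1
    cmap c \o bproj E \o cinv C}.
  apply: filterS (open_near (cimg_open (atlas_chart aC)) zC) => z zCz.
  have /tbundle_img zc := zCz; have [_ zE] := cimgP ac zc.
  by rewrite [in RHS]/comp (tbundle_invE zc) bproj_pt zE.
have dl := differentiable_lsubmx (cmap C (pt E v)).
rewrite [LHS](tcomp_dmap Z aC ve ac).
- rewrite -(near_eq_jacobian E1 dl) mul_jacobian diff_lin//.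
  exact: continuous_lsubmx.
- by rewrite bproj_pt.
- exact: bproj_continuous.
- exact: near_eq_differentiable E1 dl.
Qed.

Lemma tcomp_dmap_frame q y (X : tangent q) : cdom c q ->
  tcomp C (dmap (fun q => pt E (frame T y q)) X) = row_mx (tcomp c X) 0.
Proof.
move=> qc; have xc : cimg c (cmap c q) by exists q.
have [dr Jr] := row_mx_left_is_diff y (cmap c q) (tcomp c X).
have E1 : {near cmap c q, (fun x => row_mx x y) =1
    cmap C \o (fun q => pt E (frame T y q)) \o cinv c}.
  apply: filterS (open_near (cimg_open (atlas_chart ac)) xc) => x /(cimgP ac)[xd xE].
  by rewrite [in RHS]/comp (tbundle_frame y xd) xE.
rewrite [LHS](tcomp_dmap X ac qc aC).
- by rewrite -(near_eq_jacobian E1 dr).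
- exact: tbundle_dom.
- by apply: constant_section_continuous qc => q' qc'; exact: tcoord_frame.
- exact: near_eq_differentiable E1 dr.
Qed.

Lemma tcomp_vertical q (v w : fib E q) : cdom c q ->
  tcomp C (vertical v w) = row_mx 0 (tcoord T (pt E w)).
Proof.
move=> qc; have ve := tbundle_dom v qc.
have ac1 := chart_at_atlas (pt E v); have pc1 := chart_at_dom (pt E v).
suff -> : vertical v w = tvec C (pt E v) (row_mx 0 (tcoord T (pt E w))) by rewrite tvecK.
rewrite /vertical /tvec; set c1 := chart_at (pt E v) in ac1 pc1 *.
set u := row_mx 0 _; set z := cmap C (pt E v).
have fE : (fun t : R => cmap c1 (pt E (v + t *: w))) = trans C c1 \o (fun t : R => z + t *: u).
  apply/funext => t; rewrite /comp -(trans_cmap c1 aC (tbundle_dom (v + t *: w) qc)).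
  congr (trans C c1 _); rewrite /z /u !tbundle_pt tcoordD// tcoordZ//.
  by rewrite scale_row_mx add_row_mx scaler0 addr0.
have dt := trans_differentiable aC ac1 ve pc1.
have dl : is_diff (0 : R) (fun t : R => z + t *: u) (fun t : R => t *: u).
  have := is_diffD (is_diff_cst z (0 : R)) (is_diff_scalel (0 : R) u).
  by rewrite add0r.
have dl' : differentiable (fun t : R => z + t *: u) (0 : R) by [].
have z0 : z + (0 : R) *: u = z by rewrite scale0r addr0.
rewrite -/z -z0 in dt.
rewrite fE derive1E [LHS](derive_chain _ dl' dt) z0 (deriveE _ dl') diff_val scale1r.
by rewrite -[RHS]deriveEjacobian// -[X in differentiable _ X]z0.
Qed.

(** A tangent vector with components (a, b) is the image of a under the
    differential of a section with constant coordinates, plus the vertical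
    vector b. The connection map is prescribed on both. *)
Lemma conn_map_coord q y (Z : tangent (pt E (frame T y q))) : cdom c q ->
  tcoord T (pt E (conn_map K Z)) =
    lsubmx (tcomp C Z) *m vert_mx (conn_mx T D) (row_mx (cmap c q) y) + rsubmx (tcomp C Z).
Proof.
move=> qc; have ve := tbundle_dom (frame T y q) qc.
set a := lsubmx _; set b := rsubmx _.
pose X : tangent q := tvec c q a.
have ZE : Z = dmap (fun q => pt E (frame T y q)) X + vertical (frame T y q) (frame T b q).
  rewrite -[LHS](tcompK Z aC ve) -[RHS](tcompK _ aC ve); congr (tvec _ _ _).
  have := tcomp_linear C 1 (dmap (fun q => pt E (frame T y q)) X)
    (vertical (frame T y q) (frame T b q)).
  rewrite !scale1r => ->; rewrite tcomp_dmap_frame// tcomp_vertical// tcoord_frame//.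
  by rewrite /X tvecK// add_row_mx addr0 add0r /a /b hsubmxK.
have := conn_map_linear K 1 (dmap (fun q => pt E (frame T y q)) X)
  (vertical (frame T y q) (frame T b q)).
rewrite !scale1r -ZE => ->; rewrite tcoordD//; congr (_ + _).
  rewrite (conn_map_section K X (frame_near y qc)) cov_frame_coord// /X tvecK//.
  by rewrite mulmx_sum_row; apply: eq_bigr => i _; rewrite rowK row_mxKl row_mxKr.
by rewrite conn_map_vertical tcoord_frame.
Qed.

Lemma fib_sqnorm_frame q y : cdom c q ->
  fmetric h (frame T y q) (frame T y q) = fib_sqnorm (fib_gram T h) (row_mx (cmap c q) y).
Proof. by move=> qc; rewrite fmetric_frame// /fib_sqnorm row_mxKl row_mxKr. Qed.

(** The rows of the shear are the base and fibre coordinates of the images of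
    the coordinate vectors under the differential of the projection and under
    the connection map. *)
Lemma gram_total (g : riemannian_metric M) (phi1 phi2 : R -> R)
    (G : riemannian_metric (total_space E)) :
  spherically_symmetric g h K phi1 phi2 G ->
  forall z, cimg c (lsubmx z) ->
  gram G C z =
    shear (vert_mx (conn_mx T D) z) *m
    block_mx (expR (2 * phi1 (fib_sqnorm (fib_gram T h) z)) *: gram g c (lsubmx z)) 0
             0 (expR (2 * phi2 (fib_sqnorm (fib_gram T h) z)) *: fib_gram T h (lsubmx z)) *m
    (shear (vert_mx (conn_mx T D) z))^T.
Proof.
move=> hG z zc; have [qc qE] := cimgP ac zc.
set q := cinv c (lsubmx z) in qc qE.
pose y := rsubmx z; pose v := frame T y q.
have zE : z = row_mx (cmap c q) y by rewrite qE hsubmxK.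
have ve := tbundle_dom v qc.
have Ce : cmap C (pt E v) = z by rewrite tbundle_frame.
have GE := hG q v.
apply: mx_bilinear_inj => a b.
pose X := tvec C (pt E v) a; pose Y := tvec C (pt E v) b.
have tX : tcomp C X = a by rewrite /X tvecK.
have tY : tcomp C Y = b by rewrite /Y tvecK.
transitivity (G (pt E v) X Y); first by rewrite (metric_gram _ _ _ aC ve) tX tY Ce.
have bc : cdom c (bproj E (pt E v)) by rewrite bproj_pt.
rewrite GE fib_sqnorm_frame// -zE (metric_gram _ _ _ ac bc) !tcomp_dmap_bproj// bproj_pt tX tY.
rewrite (fmetric_tcoord h _ _ qc) !conn_map_coord// tX tY -zE qE.
set r := fib_sqnorm (fib_gram T h) z; set Q := vert_mx (conn_mx T D) z.
set A := gram g c _; set B := fib_gram T h _.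
rewrite -[in RHS](hsubmxK a) -[in RHS](hsubmxK b) shear_quadratic.
by rewrite -!scalemxAr -!scalemxAl !mxE.
Qed.

End TotalMetric.

(** * The Laplacian of a spherically symmetric metric in coordinates *)

Section BlockCalculus.
Context {R : realType} {V : normedModType R}.

Lemma differentiable_block {p1 p2 q1 q2 : nat} (A : V -> 'M[R]_(p1, q1))
    (B : V -> 'M[R]_(p1, q2)) (C : V -> 'M[R]_(p2, q1)) (D : V -> 'M[R]_(p2, q2)) (x : V) :
  differentiable A x -> differentiable B x -> differentiable C x -> differentiable D x ->
  differentiable (fun y => block_mx (A y) (B y) (C y) (D y)) x.
Proof.
move=> /differentiable_mxP dA /differentiable_mxP dB /differentiable_mxP dC
  /differentiable_mxP dD; apply/differentiable_mxP => i j.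
case: (split_ordP i) => i' ->; case: (split_ordP j) => j' ->.
- by under eq_fun do rewrite block_mxEul.
- by under eq_fun do rewrite block_mxEur.
- by under eq_fun do rewrite block_mxEdl.
- by under eq_fun do rewrite block_mxEdr.
Qed.

Lemma derive_block {p1 p2 q1 q2 : nat} (A : V -> 'M[R]_(p1, q1))
    (B : V -> 'M[R]_(p1, q2)) (C : V -> 'M[R]_(p2, q1)) (D : V -> 'M[R]_(p2, q2)) (x v : V) :
  differentiable A x -> differentiable B x -> differentiable C x -> differentiable D x ->
  'D_v (fun y => block_mx (A y) (B y) (C y) (D y)) x =
  block_mx ('D_v A x) ('D_v B x) ('D_v C x) ('D_v D x).
Proof.
move=> dA dB dC dD; apply/matrixP => i j.
rewrite (derive_mxE _ _ _ (differentiable_block dA dB dC dD)).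
case: (split_ordP i) => i' ->; case: (split_ordP j) => j' ->.
- by under eq_fun do rewrite block_mxEul; rewrite [RHS]block_mxEul derive_mxE.
- by under eq_fun do rewrite block_mxEur; rewrite [RHS]block_mxEur derive_mxE.
- by under eq_fun do rewrite block_mxEdl; rewrite [RHS]block_mxEdl derive_mxE.
- by under eq_fun do rewrite block_mxEdr; rewrite [RHS]block_mxEdr derive_mxE.
Qed.

Lemma differentiable_row_mx {p q1 q2 : nat} (A : V -> 'M[R]_(p, q1))
    (B : V -> 'M[R]_(p, q2)) (x : V) :
  differentiable A x -> differentiable B x ->
  differentiable (fun y => row_mx (A y) (B y)) x.
Proof.
move=> /differentiable_mxP dA /differentiable_mxP dB; apply/differentiable_mxP => i j.
case: (split_ordP j) => j' ->.
- by under eq_fun do rewrite row_mxEl.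
- by under eq_fun do rewrite row_mxEr.
Qed.

End BlockCalculus.

Section Projections.
Context {R : realType} {m k : nat}.

Lemma derive_lsubmx (z w : 'rV[R]_(m + k)) :
  'D_w (lsubmx : 'rV[R]_(m + k) -> 'rV[R]_m) z = lsubmx w.
Proof.
rewrite (deriveE _ (differentiable_lsubmx z)) diff_lin//.
exact: continuous_lsubmx.
Qed.

Lemma derive_rsubmx (z w : 'rV[R]_(m + k)) :
  'D_w (rsubmx : 'rV[R]_(m + k) -> 'rV[R]_k) z = rsubmx w.
Proof.
rewrite (deriveE _ (differentiable_rsubmx z)) diff_lin//.
exact: continuous_rsubmx.
Qed.

Lemma differentiable_base {W : normedModType R} (f : 'rV[R]_m -> W) (z : 'rV[R]_(m + k)) :
  differentiable f (lsubmx z) -> differentiable (fun z => f (lsubmx z)) z.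
Proof.
exact: (@differentiable_comp _ _ _ _ (lsubmx : 'rV[R]_(m + k) -> 'rV[R]_m) f z
  (differentiable_lsubmx z)).
Qed.

Lemma derive_base {W : normedModType R} (f : 'rV[R]_m -> W) (z w : 'rV[R]_(m + k)) :
  differentiable f (lsubmx z) ->
  'D_w (fun z => f (lsubmx z)) z = 'D_(lsubmx w) f (lsubmx z).
Proof.
move=> df; rewrite [LHS](derive_chain w (differentiable_lsubmx z) df).
by rewrite derive_lsubmx.
Qed.

Lemma weight_is_derive (b : R) (p q : R -> R) (t : R) :
  is_derive t 1 p (q t) ->
  is_derive t 1 (fun t => expR (b * p t)) (b * q t * expR (b * p t)).
Proof.
move=> dp; have dbp : is_derive t 1 (fun t => b * p t) (b * q t).
  have := is_deriveM (is_derive_cst b t 1) dp.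
  by rewrite scaler0 addr0.
have := @is_derive1_comp R expR (fun t => b * p t) t _ _ (is_derive_expR _) dbp.
by rewrite mulrC.
Qed.

Lemma derive_affine {V W : normedModType R} (f : V -> W) (z w : V) (l : W) :
  differentiable f z -> (forall t : R, f (z + t *: w) = f z + t *: l) -> 'D_w f z = l.
Proof.
move=> df fl.
have dl : is_diff (0 : R) (fun t : R => z + t *: w) (fun t : R => t *: w).
  have := is_diffD (is_diff_cst z (0 : R)) (is_diff_scalel (0 : R) w).
  by rewrite add0r.
have dl' : differentiable (fun t : R => z + t *: w) (0 : R) by [].
have dm : is_diff (0 : R) (fun t : R => f z + t *: l) (fun t : R => t *: l).
  have := is_diffD (is_diff_cst (f z) (0 : R)) (is_diff_scalel (0 : R) l).
  by rewrite add0r.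
have z0 : z + (0 : R) *: w = z by rewrite scale0r addr0.
rewrite -z0 in df.
have := derive_chain (1 : R) dl' df.
rewrite z0 (deriveE _ dl') diff_val scale1r => <-.
under eq_fun do rewrite fl.
have dm' : differentiable (fun t : R => f z + t *: l) (0 : R) by [].
by rewrite (deriveE _ dm') diff_val scale1r.
Qed.

Lemma drow_eq {n : nat} (w : 'rV[R]_n -> R) (x d : 'rV[R]_n) :
  (forall a, 'D_a w x = (d *m a^T) 0 0) -> drow w x = d.
Proof. by move=> wE; apply/rowP => j; rewrite mxE wE trmx_delta -colE mxE. Qed.

Lemma lsubmx_delta i : lsubmx (delta_mx 0 (lshift k i) : 'rV[R]_(m + k)) = delta_mx 0 i.
Proof. by apply/rowP => j; rewrite !mxE (inj_eq (@lshift_inj _ _)). Qed.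

Lemma lsubmx_delta0 a : lsubmx (delta_mx 0 (rshift m a) : 'rV[R]_(m + k)) = 0.
Proof. by apply/rowP => j; rewrite !mxE eq_lrshift andbF. Qed.

Lemma rsubmx_delta a : rsubmx (delta_mx 0 (rshift m a) : 'rV[R]_(m + k)) = delta_mx 0 a.
Proof. by apply/rowP => j; rewrite !mxE (inj_eq (@rshift_inj _ _)). Qed.

End Projections.

Fact trmx11 {R : realType} (M : 'M[R]_1) : M 0 0 = M^T 0 0.
Proof. by rewrite mxE. Qed.

Lemma mxtrace_congruence0 {R : realType} {n : nat} (J G DJ DG : 'M[R]_n) :
  J \in unitmx -> G \in unitmx -> \tr (invmx J *m DJ) = 0 ->
  \tr (invmx (J *m G *m J^T) *m
    (DJ *m G *m J^T + J *m DG *m J^T + J *m G *m DJ^T)) = \tr (invmx G *m DG).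
Proof. by move=> uJ uG tJ; rewrite mxtrace_congruence// tJ add0r addr0. Qed.

Definition local_grad {R : realType} {n : nat} (G : 'rV[R]_n -> 'M[R]_n)
    (u : 'rV[R]_n -> R) (x : 'rV[R]_n) : 'rV[R]_n :=
  drow u x *m invmx (G x).

Section ModelFields.
Context {R : realType} {m k : nat}.
Variables (H : 'rV[R]_m -> 'M[R]_k) (A : 'I_m -> 'rV[R]_m -> 'M[R]_k)
  (p1 p2 q1 : R -> R).

Definition weight (b : R) (p : R -> R) (z : 'rV[R]_(m + k)) : R :=
  expR (b * p (fib_sqnorm H z)).

Definition horizontal_lift (X : 'rV[R]_m -> 'rV[R]_m) (z : 'rV[R]_(m + k)) :
    'rV[R]_(m + k) :=
  row_mx (X (lsubmx z)) (- (X (lsubmx z) *m vert_mx A z)).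

(** The position vector field of the fibres. *)
Definition euler_field (z : 'rV[R]_(m + k)) : 'rV[R]_(m + k) := row_mx 0 (rsubmx z).

(** The factor psi such that the gradient of exp(-2 p1(r)) is psi times
    [euler_field], when q1 is the derivative of p1. *)
Definition radial_coef (z : 'rV[R]_(m + k)) : R :=
  - 4 * (q1 (fib_sqnorm H z) * (weight (- 2) p1 z * weight (- 2) p2 z)).

Definition weighted_lift (u : 'rV[R]_m -> R) (z : 'rV[R]_(m + k)) : R :=
  weight (- 2) p1 z * u (lsubmx z).

Definition lift_grad (gm : 'rV[R]_m -> 'M[R]_m) (u : 'rV[R]_m -> R)
    (z : 'rV[R]_(m + k)) : 'rV[R]_(m + k) :=
  weight (- 2) p1 z *: horizontal_lift (local_grad gm u) z.

Definition weighted_lift_grad (gm : 'rV[R]_m -> 'M[R]_m) (u : 'rV[R]_m -> R)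
    (z : 'rV[R]_(m + k)) : 'rV[R]_(m + k) :=
  weight (- 4) p1 z *: horizontal_lift (local_grad gm u) z +
  (u (lsubmx z) * radial_coef z) *: euler_field z.

End ModelFields.

(** What the computation in a bundle chart depends on: the Gram matrices gm, H
    and Gt of g, h and G, the connection matrices A, the exponents p1 and p2 of
    the weights with their derivatives q1 and q2, and the derivative s1 of
    q1. *)
Record spherical_model {R : realType} {m k : nat} (Om : set 'rV[R]_m)
    (gm : 'rV[R]_m -> 'M[R]_m) (H : 'rV[R]_m -> 'M[R]_k)
    (A : 'I_m -> 'rV[R]_m -> 'M[R]_k) (p1 p2 q1 q2 s1 : R -> R)
    (Gt : 'rV[R]_(m + k) -> 'M[R]_(m + k)) : Prop := SphericalModel {
  model_open : open Om;
  model_base_diff : forall x, Om x -> differentiable gm x;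
  model_fib_diff : forall x, Om x -> differentiable H x;
  model_base_unit : forall x, Om x -> gm x \in unitmx;
  model_fib_unit : forall x, Om x -> H x \in unitmx;
  model_fib_sym : forall x, (H x)^T = H x;
  model_compatible : forall x i, Om x ->
    'D_(delta_mx 0 i) H x = A i x *m H x + H x *m (A i x)^T;
  model_fib_ge0 : forall x (y : 'rV[R]_k), Om x -> 0 <= (y *m H x *m y^T) 0 0;
  model_weight1 : forall t : R, 0 <= t -> is_derive t 1 p1 (q1 t);
  model_weight2 : forall t : R, 0 <= t -> is_derive t 1 p2 (q2 t);
  model_weight1' : forall t : R, 0 <= t -> is_derive t 1 q1 (s1 t);
  model_diff : forall z, Om (lsubmx z) -> differentiable Gt z;
  model_gram : forall z, Om (lsubmx z) -> Gt z =
    shear (vert_mx A z) *m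
    block_mx (expR (2 * p1 (fib_sqnorm H z)) *: gm (lsubmx z)) 0
             0 (expR (2 * p2 (fib_sqnorm H z)) *: H (lsubmx z)) *m
    (shear (vert_mx A z))^T
}.

Section LocalModel.
Context {R : realType} {m k : nat} {Om : set 'rV[R]_m}
  {gm : 'rV[R]_m -> 'M[R]_m} {H : 'rV[R]_m -> 'M[R]_k}
  {A : 'I_m -> 'rV[R]_m -> 'M[R]_k} {p1 p2 q1 q2 s1 : R -> R}
  {Gt : 'rV[R]_(m + k) -> 'M[R]_(m + k)}.
Hypothesis model : spherical_model Om gm H A p1 p2 q1 q2 s1 Gt.
Let oOm := model_open model.
Let dgm := model_base_diff model.
Let dH := model_fib_diff model.
Let ugm := model_base_unit model.
Let uH := model_fib_unit model.
Let symH := model_fib_sym model.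
Let DHE := model_compatible model.
Let posH := model_fib_ge0 model.
Let dp1 := model_weight1 model.
Let dp2 := model_weight2 model.
Let dq1 := model_weight1' model.
Let dGt := model_diff model.
Let GtE := model_gram model.
Let avert : 'rV[R]_(m + k) -> 'M[R]_(m, k) := vert_mx A.
Let rad : 'rV[R]_(m + k) -> R := fib_sqnorm H.

Let Adir (x u : 'rV[R]_m) : 'M[R]_k := \sum_i u 0 i *: A i x.

Lemma near_Om (z : 'rV[R]_(m + k)) : Om (lsubmx z) -> \forall z' \near z, Om (lsubmx z').
Proof.
move=> zO; apply: continuous_lsubmx.
exact: open_near oOm zO.
Qed.

Lemma avert_mul (z : 'rV[R]_(m + k)) u : u *m avert z = rsubmx z *m Adir (lsubmx z) u.
Proof.
rewrite mulmx_sum_row mulmx_sumr; apply: eq_bigr => i _.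
by rewrite rowK scalemxAr.
Qed.

Lemma D_H x u : Om x -> 'D_u H x = Adir x u *m H x + H x *m (Adir x u)^T.
Proof.
move=> xO; rewrite (derive_basis _ (dH xO)) mulmx_suml linear_sum mulmx_sumr -big_split.
apply: eq_bigr => i _; rewrite DHE// scalerDr -scalemxAl; congr (_ + _).
by rewrite [in RHS]linearZ/= -scalemxAr.
Qed.

Lemma rad_diff (z : 'rV[R]_(m + k)) : Om (lsubmx z) -> differentiable rad z.
Proof.
move=> zO; apply: (differentiable_mxP
  (fun z => rsubmx z *m H (lsubmx z) *m (rsubmx z)^T) z).1.
apply: differentiable_mulmx; last exact/differentiable_trmx/differentiable_rsubmx.
apply: differentiable_mulmx; first exact: differentiable_rsubmx.
exact/differentiable_base/dH.
Qed.

(** By compatibility, the derivative of h(e, e) along a tangent vector is twice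
    the product of e with the image of the vector under the connection map. *)
Lemma D_rad (z w : 'rV[R]_(m + k)) : Om (lsubmx z) ->
  'D_w rad z = 2 * (rsubmx z *m H (lsubmx z) *m
    (lsubmx w *m avert z + rsubmx w)^T) 0 0.
Proof.
move=> zO; have dr := differentiable_rsubmx z; have drT := differentiable_trmx dr.
have dHz := differentiable_base (dH zO).
have dyH := differentiable_mulmx dr dHz.
have dyHy := differentiable_mulmx dyH drT.
rewrite -[LHS](derive_mxE w 0 0 dyHy) (derive_mulmx w dyH drT) (derive_mulmx w dr dHz).
rewrite (derive_trmx w dr) derive_rsubmx (derive_base w (dH zO)) (D_H _ zO).
set y := rsubmx z; set w2 := rsubmx w; set x := lsubmx z; set w1 := lsubmx w.
rewrite mulmxDr !mulmxDl avert_mul -/y -/x; set B := Adir x w1.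
have e1 : (w2 *m H x *m y^T) 0 0 = (y *m H x *m w2^T) 0 0.
  by rewrite trmx11 !trmx_mul trmxK symH mulmxA.
have e2 : (y *m (B *m H x) *m y^T) 0 0 = (y *m H x *m (y *m B)^T) 0 0.
  by rewrite trmx11 !trmx_mul trmxK symH !mulmxA.
have e3 : (y *m (H x *m B^T) *m y^T) 0 0 = (y *m H x *m (y *m B)^T) 0 0.
  by rewrite trmx_mul !mulmxA.
rewrite linearD mulmxDr.
have add00 (N N' : 'M[R]_1) : (N + N') 0 0 = N 0 0 + N' 0 0 by rewrite mxE.
rewrite !add00 e1 e2 e3; move: (_ 0 0) (_ 0 0) => a b; ring.
Qed.

Lemma rad_ge0 (z : 'rV[R]_(m + k)) : Om (lsubmx z) -> 0 <= rad z.
Proof. by move=> zO; exact: posH. Qed.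

Lemma weight_differentiable (b : R) (p q : R -> R) (z : 'rV[R]_(m + k)) :
  (forall t : R, 0 <= t -> is_derive t 1 p (q t)) -> Om (lsubmx z) ->
  differentiable (fun z => expR (b * p (rad z))) z.
Proof.
move=> dp zO; apply: (@differentiable_comp _ _ _ _ rad (fun t => expR (b * p t))).
  exact: rad_diff.
apply/derivable1_diffP.
by have [] := weight_is_derive b (dp _ (rad_ge0 zO)).
Qed.

Lemma derive_weight (b : R) (p q : R -> R) (z w : 'rV[R]_(m + k)) :
  (forall t : R, 0 <= t -> is_derive t 1 p (q t)) -> Om (lsubmx z) ->
  'D_w (fun z => expR (b * p (rad z))) z =
  b * q (rad z) * expR (b * p (rad z)) * 'D_w rad z.
Proof.
move=> dp zO.
exact: (derive_chain1 w (rad_diff zO) (weight_is_derive b (dp _ (rad_ge0 zO)))).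
Qed.

Lemma Gt_unit (z : 'rV[R]_(m + k)) : Om (lsubmx z) -> Gt z \in unitmx.
Proof.
move=> zO; rewrite GtE// !unitmx_mul unitmx_tr shear_unit block_diag_mx_unit.
by rewrite !unitmxZ ?ugm ?uH// unitfE gt_eqF// expR_gt0.
Qed.

(** The off-diagonal block of Gt, which is differentiable, determines
    [vert_mx A]. *)
Lemma avert_differentiable (z : 'rV[R]_(m + k)) : Om (lsubmx z) -> differentiable avert z.
Proof.
move=> zO; pose B z := expR (2 * p2 (rad z)) *: H (lsubmx z).
have uB z' : Om (lsubmx z') -> B z' \in unitmx.
  by move=> zO'; rewrite unitmxZ ?uH// unitfE gt_eqF// expR_gt0.
have dB : differentiable B z.
  apply: differentiable_scalemx; first exact: weight_differentiable dp2 zO.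
  exact/differentiable_base/dH.
have E : \forall z' \near z, ursubmx (Gt z') *m invmx (B z') = avert z'.
  apply: filterS (near_Om zO) => z' zO'.
  rewrite GtE// /shear tr_block_mx !mulmx_block block_mxKur.
  by rewrite !trmx1 trmx0 !mulmx0 !mulmx1 !add0r mulmxK//; exact: uB.
apply: near_eq_differentiable E _; apply: differentiable_mulmx.
  apply/differentiable_mxP => i j; under eq_fun do rewrite !mxE.
  exact: (differentiable_mxP _ _).1 (dGt zO) _ _.
by apply: differentiable_invmx dB; apply: filterS (near_Om zO) => z'; exact: uB.
Qed.

(** The shear has determinant 1, so only the block diagonal factor
    contributes. *)
Lemma mxtrace_dlog (z w : 'rV[R]_(m + k)) : Om (lsubmx z) ->
  2^-1 * \tr (invmx (Gt z) *m 'D_w Gt z) =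
  2^-1 * \tr (invmx (gm (lsubmx z)) *m 'D_(lsubmx w) gm (lsubmx z)) +
  2^-1 * \tr (invmx (H (lsubmx z)) *m 'D_(lsubmx w) H (lsubmx z)) +
  (m%:R * q1 (rad z) + k%:R * q2 (rad z)) * 'D_w rad z.
Proof.
move=> zO.
pose B1 z := expR (2 * p1 (rad z)) *: gm (lsubmx z).
pose B2 z := expR (2 * p2 (rad z)) *: H (lsubmx z).
pose B z := block_mx (B1 z) 0 0 (B2 z).
have w1 := weight_differentiable 2 dp1 zO.
have w2 := weight_differentiable 2 dp2 zO.
have dgz := differentiable_base (dgm zO).
have dHz := differentiable_base (dH zO).
have dB1 : differentiable B1 z := differentiable_scalemx w1 dgz.
have dB2 : differentiable B2 z := differentiable_scalemx w2 dHz.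
have d0 p q : differentiable (fun _ : 'rV[R]_(m + k) => 0 : 'M[R]_(p, q)) z.
  exact: differentiable_cst.
have d1 p : differentiable (fun _ : 'rV[R]_(m + k) => 1%:M : 'M[R]_p) z.
  exact: differentiable_cst.
have dB : differentiable B z := differentiable_block dB1 (d0 _ _) (d0 _ _) dB2.
have da := avert_differentiable zO.
have dS : differentiable (fun z => shear (avert z)) z :=
  differentiable_block (d1 _) da (d0 _ _) (d1 _).
have dST := differentiable_trmx dS.
have dSB := differentiable_mulmx dS dB.
have E : {near z, Gt =1 fun z => shear (avert z) *m B z *m (shear (avert z))^T}.
  by apply: filterS (near_Om zO) => z' zO'; rewrite GtE.
rewrite [in LHS](near_eq_derive w E) (GtE zO) -/(B1 z) -/(B2 z) -/(B z).
rewrite (derive_mulmx w dSB dST) (derive_mulmx w dS dB) (derive_trmx w dS).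
have uB1 : B1 z \in unitmx by rewrite unitmxZ ?ugm// unitfE gt_eqF// expR_gt0.
have uB2 : B2 z \in unitmx by rewrite unitmxZ ?uH// unitfE gt_eqF// expR_gt0.
have uB : B z \in unitmx by rewrite block_diag_mx_unit uB1.
have trS : \tr (invmx (shear (avert z)) *m 'D_w (fun z => shear (avert z)) z) = 0.
  rewrite (derive_block w (d1 _) da (d0 _ _) (d1 _)) !derive_cst invmx_shear.
  by rewrite mulmx_block !mulmx0 !mul0mx !addr0 mxtrace_block !mxtrace0 addr0.
rewrite mulmxDl (mxtrace_congruence0 _ (shear_unit _) uB trS).
rewrite (derive_block w dB1 (d0 _ _) (d0 _ _) dB2) !derive_cst.
rewrite invmx_block_diag// mulmx_block !mulmx0 !mul0mx !addr0 !add0r mxtrace_block.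
rewrite (derive_scalemx w w1 dgz) (derive_scalemx w w2 dHz).
rewrite (derive_weight 2 w dp1 zO) (derive_weight 2 w dp2 zO).
rewrite (derive_base w (dgm zO)) (derive_base w (dH zO)).
rewrite (mxtrace_scale _ _ _ (ugm zO)) ?gt_eqF ?expR_gt0//.
rewrite (mxtrace_scale _ _ _ (uH zO)) ?gt_eqF ?expR_gt0//.
have e1 : expR (2 * p1 (rad z)) != 0 by rewrite gt_eqF// expR_gt0.
have e2 : expR (2 * p2 (rad z)) != 0 by rewrite gt_eqF// expR_gt0.
move: e1 e2; set x1 := expR _; set x2 := expR _.
set t1 := \tr _; set t2 := \tr _; set dr := 'D_w rad z.
by clearbody x1 x2 t1 t2 dr => e1 e2; field; rewrite e1 e2.
Qed.

(** The differential of a lift vanishes on vertical vectors, so its gradient is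
    horizontal. *)
Lemma drow_base (u : 'rV[R]_m -> R) (z : 'rV[R]_(m + k)) : Om (lsubmx z) ->
  differentiable u (lsubmx z) ->
  drow (fun z => u (lsubmx z)) z *m invmx (Gt z) =
  lift_grad H A p1 gm u z.
Proof.
move=> zO du; rewrite /lift_grad /horizontal_lift; set Z := local_grad gm u _.
apply: (canLR (mulmxK (Gt_unit zO))).
apply: drow_eq => w; rewrite (derive_base w du) GtE// -(hsubmxK w).
rewrite -scalemxAl -scalemxAl mxE shear_quadratic subrr !mul0mx [X in _ + X]mxE addr0 row_mxKl.
rewrite -scalemxAr -scalemxAl mxE mulrA /weight -expRD mulNr addNr expR0 mul1r.
by rewrite /Z /local_grad mulmxKV ?ugm// drow_mul.
Qed.

(** The differential of h(e, e) vanishes on horizontal vectors, so its gradient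
    is vertical. *)
Lemma drow_rad (z : 'rV[R]_(m + k)) : Om (lsubmx z) ->
  drow rad z *m invmx (Gt z) =
  (2 * expR (- 2 * p2 (rad z))) *: row_mx 0 (rsubmx z).
Proof.
move=> zO; apply: (canLR (mulmxK (Gt_unit zO))).
apply: drow_eq => w; rewrite D_rad// GtE// -[in RHS](hsubmxK w).
rewrite -scalemxAl -scalemxAl [in RHS]mxE shear_quadratic !mul0mx [X in _ = _ * (X + _)]mxE !add0r.
rewrite -scalemxAr -scalemxAl [in RHS]mxE mulrA -[2 * _ * _]mulrA -expRD.
by rewrite mulNr addNr expR0 mulr1.
Qed.

Lemma D_rad_horizontal (z : 'rV[R]_(m + k)) a : Om (lsubmx z) ->
  'D_(row_mx a (- (a *m avert z))) rad z = 0.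
Proof.
by move=> zO; rewrite D_rad// row_mxKl row_mxKr subrr trmx0 mulmx0 mxE mulr0.
Qed.

Lemma D_rad_vertical (z : 'rV[R]_(m + k)) : Om (lsubmx z) ->
  'D_(row_mx 0 (rsubmx z)) rad z = 2 * rad z.
Proof. by move=> zO; rewrite D_rad// row_mxKl row_mxKr mul0mx add0r. Qed.

(** [vert_mx A] is linear along the fibres. *)
Lemma derive_avert_vertical (z : 'rV[R]_(m + k)) (b : 'rV[R]_k) : Om (lsubmx z) ->
  'D_(row_mx 0 b) avert z = avert (row_mx (lsubmx z) b).
Proof.
move=> zO; apply: derive_affine; first exact: avert_differentiable.
move=> t; apply/row_matrixP => i.
rewrite [RHS]linearD/= [in RHS]linearZ/= /avert /vert_mx !rowK row_mxKl row_mxKr.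
have -> : lsubmx (z + t *: row_mx 0 b) = lsubmx z.
  by rewrite linearD linearZ/= row_mxKl scaler0 addr0.
have -> : rsubmx (z + t *: row_mx 0 b) = rsubmx z + t *: b.
  by rewrite linearD linearZ/= row_mxKr.
by rewrite mulmxDl scalemxAl.
Qed.

(** The fibre components of the lift contribute minus the trace of the
    connection matrix along Z. The volume of h varies along Z by plus this
    trace, by compatibility, and the weights are constant along the lift. *)
Lemma ldiv_horizontal (Z : 'rV[R]_m -> 'rV[R]_m) (z : 'rV[R]_(m + k)) :
  Om (lsubmx z) -> differentiable Z (lsubmx z) ->
  ldiv Gt (horizontal_lift A Z) z =
  ldiv gm Z (lsubmx z).
Proof.
move=> zO dZ; set X := horizontal_lift A Z; set x := lsubmx z in zO dZ *.
have dZz := differentiable_base dZ.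
have da := avert_differentiable zO.
have dZa := differentiable_mulmx dZz da.
have dX : differentiable X z := differentiable_row_mx dZz (differentiableN dZa).
rewrite /ldiv mxtrace_dlog// D_rad_horizontal// mulr0 addr0 row_mxKl -/x.
have -> : \tr (jacobian X z) = \tr (jacobian Z x) - \tr (Adir x (Z x)).
  rewrite /mxtrace big_split_ord/= -sumrN; congr (_ + _).
    apply: eq_bigr => i _; rewrite [LHS](jacobianE _ _ dX) [RHS](jacobianE _ _ dZ).
    under eq_fun do rewrite /X /horizontal_lift row_mxEl.
    have dZi := (differentiable_mxP _ _).1 dZ 0 i.
    by rewrite [LHS](derive_base _ dZi) lsubmx_delta.
  apply: eq_bigr => a _; rewrite [LHS](jacobianE _ _ dX).
  under eq_fun do rewrite /X /horizontal_lift row_mxEr mxE.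
  have dZaa := (differentiable_mxP _ _).1 dZa 0 a.
  have dd : derivable (fun y => (Z (lsubmx y) *m avert y) 0 a) z (delta_mx 0 (rshift m a)).
    exact: diff_derivable.
  apply: etrans (deriveN dd) _; rewrite -(derive_mxE _ _ _ dZa).
  rewrite (derive_mulmx _ dZz da) (derive_base _ dZ) lsubmx_delta0 derive0 mul0mx add0r.
  rewrite -[delta_mx 0 _]hsubmxK lsubmx_delta0 rsubmx_delta derive_avert_vertical//.
  by rewrite avert_mul row_mxKl row_mxKr -rowE mxE.
have uHx := uH zO.
have tH : \tr (invmx (H x) *m 'D_(Z x) H x) = \tr (Adir x (Z x)) + \tr (Adir x (Z x)).
  rewrite (D_H _ zO) mulmxDr mxtraceD; congr (_ + _).
    by rewrite mulmxA mxtrace_mulC mulmxA mulmxV// mul1mx.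
  by rewrite mulKmx// mxtrace_tr.
rewrite tH.
set t1 := \tr _; set t2 := \tr _; set t3 := \tr _.
by clearbody t1 t2 t3; field.
Qed.

(** The dimension k is the divergence of the position field of R^k; the rest is
    the growth of the weights along the field, since r grows at rate 2 r. *)
Lemma ldiv_vertical (z : 'rV[R]_(m + k)) : Om (lsubmx z) ->
  ldiv Gt (@euler_field R m k) z =
  k%:R + 2 * rad z * (m%:R * q1 (rad z) + k%:R * q2 (rad z)).
Proof.
move=> zO; set X := (X in ldiv _ X _).
have dr := differentiable_rsubmx z.
have d0 : differentiable (fun _ : 'rV[R]_(m + k) => 0 : 'rV[R]_m) z.
  exact: differentiable_cst.
have dX : differentiable X z := differentiable_row_mx d0 dr.
rewrite /ldiv mxtrace_dlog// D_rad_vertical// row_mxKl !derive0 !mulmx0 !mxtrace0.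
rewrite !mulr0 !add0r [_ * (2 * _)]mulrC; congr (_ + _).
rewrite /mxtrace big_split_ord/= big1 ?add0r => [|i _]; last first.
  rewrite [LHS](jacobianE _ _ dX); under eq_fun do rewrite /X /euler_field row_mxEl mxE.
  exact: derive_cst.
rewrite -[k in RHS]card_ord -sumr_const; apply: eq_bigr => a _.
rewrite [LHS](jacobianE _ _ dX); under eq_fun do rewrite /X /euler_field row_mxEr.
rewrite -[LHS](derive_mxE _ _ _ dr) derive_rsubmx rsubmx_delta mxE.
by rewrite !eqxx.
Qed.

Section WithFunction.
Variable u : 'rV[R]_m -> R.
Hypotheses (du : forall x, Om x -> differentiable u x)
  (ddu : forall x, Om x -> differentiable (drow u) x).

Let grad := local_grad gm u.
Let hor : 'rV[R]_(m + k) -> 'rV[R]_(m + k) := horizontal_lift A grad.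
Let ver : 'rV[R]_(m + k) -> 'rV[R]_(m + k) := @euler_field R m k.

Lemma grad_differentiable x : Om x -> differentiable grad x.
Proof.
move=> xO; apply: differentiable_mulmx; first exact: ddu.
by apply: differentiable_invmx; [apply: filterS (open_near oOm xO)|exact: dgm].
Qed.

Lemma hor_differentiable (z : 'rV[R]_(m + k)) : Om (lsubmx z) -> differentiable hor z.
Proof.
move=> zO; have dg := differentiable_base (grad_differentiable zO).
apply: (differentiable_row_mx dg); apply: differentiableN.
by apply: (differentiable_mulmx dg); exact: avert_differentiable.
Qed.

Lemma ver_differentiable (z : 'rV[R]_(m + k)) : differentiable ver z.
Proof.
apply: differentiable_row_mx; first exact: differentiable_cst.
exact: differentiable_rsubmx.
Qed.

Let E1 : 'rV[R]_(m + k) -> R := weight H (- 2) p1.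
Let E2 : 'rV[R]_(m + k) -> R := weight H (- 2) p2.
Let psi : 'rV[R]_(m + k) -> R := radial_coef H p1 p2 q1.

Lemma lift_field_differentiable (z : 'rV[R]_(m + k)) : Om (lsubmx z) ->
  differentiable (lift_grad H A p1 gm u) z.
Proof.
move=> zO; apply: differentiable_scalemx (hor_differentiable zO).
exact: weight_differentiable dp1 zO.
Qed.

Lemma ldiv_lift_field (z : 'rV[R]_(m + k)) : Om (lsubmx z) ->
  ldiv Gt (lift_grad H A p1 gm u) z = weight H (- 2) p1 z * ldiv gm (local_grad gm u) (lsubmx z).
Proof.
move=> zO; have dw := weight_differentiable (- 2) dp1 zO.
rewrite [LHS](ldivZ (dGt zO) dw (hor_differentiable zO)).
rewrite [X in _ + X](derive_weight _ _ dp1 zO) [X in _ + _ * X]D_rad_horizontal//.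
rewrite mulr0 addr0; congr (_ * _).
by apply: ldiv_horizontal => //; exact: grad_differentiable.
Qed.

Lemma weighted_lift_differentiable (z : 'rV[R]_(m + k)) : Om (lsubmx z) ->
  differentiable (weighted_lift H p1 u) z.
Proof.
move=> zO; apply: differentiable_mul; first exact: weight_differentiable dp1 zO.
exact/differentiable_base/du.
Qed.

(** The product rule splits the gradient into a horizontal part, from u, and a
    radial part, from the weight. *)
Lemma drow_weighted_lift (z : 'rV[R]_(m + k)) : Om (lsubmx z) ->
  drow (weighted_lift H p1 u) z *m invmx (Gt z) = weighted_lift_grad H A p1 p2 q1 gm u z.
Proof.
move=> zO; have dw : differentiable E1 z := weight_differentiable (- 2) dp1 zO.
have duz := differentiable_base (du zO).
have -> : drow (weighted_lift H p1 u) z =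
    E1 z *: drow (fun z => u (lsubmx z)) z +
    (u (lsubmx z) * (- 2 * q1 (rad z) * E1 z)) *: drow rad z.
  apply/rowP => j; rewrite !mxE.
  have dw' : derivable E1 z (delta_mx 0 j) by exact: diff_derivable.
  have du' : derivable (fun z => u (lsubmx z)) z (delta_mx 0 j) by exact: diff_derivable.
  apply: etrans (deriveM dw' du') _; congr (_ + _).
  by rewrite -[RHS]mulrA; congr (_ * _); exact: derive_weight dp1 zO.
rewrite mulmxDl -!scalemxAl drow_base ?drow_rad//; last exact: du.
rewrite !scalerA -/(E1 z) -/(E2 z); congr (_ *: _ + _ *: _).
  by rewrite /E1 /weight -expRD; congr expR; ring.
by rewrite -[expR (- 2 * p2 _)]/(E2 z) /radial_coef -/(E1 z) -/(E2 z) -/rad; ring.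
Qed.

Lemma psi_differentiable (z : 'rV[R]_(m + k)) : Om (lsubmx z) ->
  differentiable (fun z => q1 (rad z)) z /\ differentiable psi z.
Proof.
move=> zO; have d1 : differentiable E1 z := weight_differentiable (- 2) dp1 zO.
have d2 : differentiable E2 z := weight_differentiable (- 2) dp2 zO.
have dqr : differentiable (fun z => q1 (rad z)) z.
  apply: (@differentiable_comp _ _ _ _ rad q1); first exact: rad_diff.
  by apply/derivable1_diffP; case: (dq1 (rad_ge0 zO)).
split=> //; apply: (@differentiable_mul _ _ (cst (- 4))).
  exact: differentiable_cst.
exact/(differentiable_mul dqr)/differentiable_mul.
Qed.

Lemma weighted_field_differentiable (z : 'rV[R]_(m + k)) : Om (lsubmx z) ->
  differentiable (weighted_lift_grad H A p1 p2 q1 gm u) z.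
Proof.
move=> zO; have d4 := weight_differentiable (- 4) dp1 zO.
have [_ dpsi] := psi_differentiable zO.
have dup := differentiable_mul (differentiable_base (du zO)) dpsi.
apply: differentiable_add; first exact: differentiable_scalemx d4 (hor_differentiable zO).
exact: differentiable_scalemx dup (ver_differentiable z).
Qed.

Lemma derive_psi_vertical (z : 'rV[R]_(m + k)) : Om (lsubmx z) ->
  'D_(ver z) psi z = - 8 * rad z * (E1 z * E2 z) *
    (s1 (rad z) - 2 * q1 (rad z) * (q1 (rad z) + q2 (rad z))).
Proof.
move=> zO.
have d1 : differentiable E1 z := weight_differentiable (- 2) dp1 zO.
have d2 : differentiable E2 z := weight_differentiable (- 2) dp2 zO.
have [dqr dpsi] := psi_differentiable zO.
have dE := differentiable_mul d1 d2.
have dqE := differentiable_mul dqr dE.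
have D (f f' : 'rV[R]_(m + k) -> R) : differentiable f z -> differentiable f' z ->
    'D_(ver z) (fun z => f z * f' z) z = f z * 'D_(ver z) f' z + f' z * 'D_(ver z) f z.
  by move=> df df'; apply: deriveM; exact: diff_derivable.
have Dver : 'D_(ver z) rad z = 2 * rad z by exact: D_rad_vertical.
have DE1 : 'D_(ver z) E1 z = - 2 * q1 (rad z) * E1 z * (2 * rad z).
  by rewrite -Dver; exact: derive_weight dp1 zO.
have DE2 : 'D_(ver z) E2 z = - 2 * q2 (rad z) * E2 z * (2 * rad z).
  by rewrite -Dver; exact: derive_weight dp2 zO.
have Dq : 'D_(ver z) (fun z => q1 (rad z)) z = s1 (rad z) * (2 * rad z).
  by rewrite -Dver; exact: (derive_chain1 _ (rad_diff zO) (dq1 (rad_ge0 zO))).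
have := D (cst (- 4)) _ (differentiable_cst _ _) dqE.
rewrite derive_cst mulr0 addr0 (D _ _ dqr dE) (D _ _ d1 d2) DE1 DE2 Dq => ->.
move: (E1 z) (E2 z) (rad z) => e1 e2 r; rewrite /cst.
by move: (q1 r) (q2 r) (s1 r) => a b c; ring.
Qed.

(** The weight is constant along the horizontal part and u is constant along
    the radial part, so the product rule leaves the divergences of the two
    fields and the radial derivative of [radial_coef]. *)
Lemma ldiv_weighted_field (z : 'rV[R]_(m + k)) : Om (lsubmx z) ->
  ldiv Gt (weighted_lift_grad H A p1 p2 q1 gm u) z =
  expR (- (4 * p1 (rad z))) * ldiv gm (local_grad gm u) (lsubmx z)
  - 4 * expR (- (2 * (p1 (rad z) + p2 (rad z))))
    * (2 * rad z * s1 (rad z)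
       - 4 * rad z * q1 (rad z) * (q1 (rad z) + q2 (rad z))
       + 2 * m%:R * rad z * q1 (rad z) ^+ 2
       + 2 * k%:R * rad z * q1 (rad z) * q2 (rad z)
       + k%:R * q1 (rad z))
    * u (lsubmx z).
Proof.
move=> zO; have d4 := weight_differentiable (- 4) dp1 zO.
have duz := differentiable_base (du zO).
have [_ dpsi] := psi_differentiable zO.
have dup := differentiable_mul duz dpsi.
have dh := hor_differentiable zO.
have dv := ver_differentiable z.
have L1 : ldiv Gt (fun z => expR (- 4 * p1 (rad z)) *: hor z) z =
    expR (- 4 * p1 (rad z)) * ldiv gm grad (lsubmx z).
  rewrite [LHS](ldivZ (dGt zO) d4 dh) [X in _ + X](derive_weight _ _ dp1 zO).
  rewrite [X in _ + _ * X]D_rad_horizontal// mulr0 addr0; congr (_ * _).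
  by apply: ldiv_horizontal => //; exact: grad_differentiable.
have L2 := ldivZ (dGt zO) dup dv; rewrite ldiv_vertical// in L2.
have D : 'D_(ver z) (fun z => u (lsubmx z) * psi z) z = u (lsubmx z) * 'D_(ver z) psi z.
  have du' : derivable (fun z => u (lsubmx z)) z (ver z) by exact: diff_derivable.
  have dpsi' : derivable psi z (ver z) by exact: diff_derivable.
  apply: etrans (deriveM du' dpsi') _.
  by rewrite [X in _ + _ *: X](derive_base _ (du zO)) row_mxKl derive0 scaler0 addr0.
rewrite [LHS](ldivD (dGt zO) (differentiable_scalemx d4 dh) (differentiable_scalemx dup dv)).
rewrite L1 L2 D derive_psi_vertical//.
have -> : expR (- (2 * (p1 (rad z) + p2 (rad z)))) = E1 z * E2 z.
  by rewrite /E1 /E2 /weight -expRD; congr expR; ring.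
rewrite /psi /radial_coef -/(E1 z) -/(E2 z) -/rad -(mulNr 4 (p1 _)); move: (ldiv gm grad _) => L.
move: (E1 z) (E2 z) (rad z) (u _) => e1 e2 r v.
by move: (q1 r) (q2 r) (s1 r) (expR _) => a b c e; ring.
Qed.

End WithFunction.

End LocalModel.

(** * The bilaplacian of a vertical lift *)

Lemma fmetric_ge0 {R : realType} {m k : nat} {M : manifold R m} {E : vector_bundle k M}
    (h : fiber_metric E) (q : M) (v : fib E q) : 0 <= fmetric h v v.
Proof.
have [->|v0] := eqVneq v 0; last exact/ltW/fmetric_pos.
have := fmetric_linear h (0 : fib E q) (- 1) 0 0.
by rewrite scaleN1r oppr0 addr0 mulN1r addNr => ->.
Qed.

Section Lift.
Context {R : realType} {m k : nat} {M : manifold R m} {g : riemannian_metric M}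
  {E : vector_bundle k M} {h : fiber_metric E} {D : connection E}
  {K : connection_map D} {phi1 phi2 : R -> R}
  {G : riemannian_metric (total_space E)}.
Hypotheses (hD : compatible D h) (hphi1 : smooth_Rplus phi1)
  (hphi2 : smooth_Rplus phi2) (hG : spherically_symmetric g h K phi1 phi2 G).

Let p1 := half_line_extension phi1.
Let p2 := half_line_extension phi2.
Let q1 := half_line_extension (deriv_Rplus phi1).
Let q2 := half_line_extension (deriv_Rplus phi2).
Let s1 := half_line_extension (deriv_Rplus (deriv_Rplus phi1)).

Lemma is_derive_iterate (phi : R -> R) (j : nat) (t : R) : smooth_Rplus phi -> 0 <= t ->
  is_derive t 1 (half_line_extension (iter j deriv_Rplus phi))
    (half_line_extension (iter j.+1 deriv_Rplus phi) t).
Proof.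
move=> sphi t0; rewrite (half_line_extensionE _ t0).
exact: is_derive_half_line_extension (sphi j t t0).
Qed.

(** The extended weights agree with the given ones at r = h(e, e), which is
    nonnegative. *)
Lemma total_spherical_model (T : trivialization E) :
  spherical_model (cimg (tchart T)) (gram g (tchart T)) (fib_gram T h)
    (conn_mx T D) p1 p2 q1 q2 s1 (gram G (tbundle T)).
Proof.
have ac := tchart_atlas T; have aC := tbundle_atlas T.
have cP x : cimg (tchart T) x -> exists2 q, cdom (tchart T) q & cmap (tchart T) q = x by [].
have posH x (y : 'rV[R]_k) : cimg (tchart T) x -> 0 <= (y *m fib_gram T h x *m y^T) 0 0.
  move=> [q qc <-]; rewrite -fmetric_frame//.
  exact: fmetric_ge0.
split.
- exact: cimg_open (atlas_chart ac).
- by move=> _ [q qc <-]; exact: gram_differentiable.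
- by move=> x xc; exact: smooth_differentiable (fib_gram_smooth T h) xc.
- by move=> _ [q qc <-]; exact: gram_unit.
- by move=> _ [q qc <-]; exact: fib_gram_unit.
- exact: fib_gram_sym.
- by move=> _ i [q qc <-]; exact: derive_fib_gram.
- exact: posH.
- by move=> t; exact: (is_derive_iterate 0 hphi1).
- by move=> t; exact: (is_derive_iterate 0 hphi2).
- by move=> t; exact: (is_derive_iterate 1 hphi1).
- move=> z zc; apply: smooth_differentiable (gram_smooth G aC) _.
  exact/tbundle_img.
- move=> z zc; rewrite /p1 /p2 !half_line_extensionE; try exact: posH.
  exact: gram_total.
Qed.

Section SmoothFunction.
Variables (u : M -> R) (hu : smooth_fun [set: M] u) (T : trivialization E).
Let c := tchart T.
Let C := tbundle T.
Let w := u \o cinv c.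
Let model := total_spherical_model T.
Let ac : atlas M c := tchart_atlas T.
Let aC : atlas (total_space E) C := tbundle_atlas T.

Lemma smooth_rep : smooth_on (cimg c) w.
Proof. by have := hu ac; rewrite setTI. Qed.

Lemma rep_differentiable x : cimg c x -> differentiable w x.
Proof. exact: smooth_differentiable smooth_rep. Qed.

Lemma drow_rep_differentiable x : cimg c x -> differentiable (drow w) x.
Proof.
by apply: smooth_differentiable; apply: smooth_drow smooth_rep; exact: cimg_open (atlas_chart ac).
Qed.

Lemma open_tbundle_base : open [set z : 'rV[R]_(m + k) | cimg c (lsubmx z)].
Proof.
rewrite (_ : [set z | _] = cimg C); first exact: cimg_open (atlas_chart aC).
by apply/seteqP; split=> z /tbundle_img.
Qed.

Lemma laplacian_lift_frame (q : M) (y : 'rV[R]_k) : cdom c q ->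
  laplacian G (u \o bproj E) (pt E (frame T y q)) =
  expR (- 2 * p1 (fmetric h (frame T y q) (frame T y q))) * laplacian g u q.
Proof.
move=> qc; have ve := tbundle_dom (frame T y q) qc.
have zE := tbundle_frame y qc.
have zO : cimg c (lsubmx (row_mx (cmap c q) y)) by rewrite row_mxKl; exists q.
rewrite [LHS](laplacian_chart (g := G) aC ve open_tbundle_base (w := fun z => w (lsubmx z))
  (X := lift_grad (fib_gram T h) (conn_mx T D) p1 (gram g c) w)).
- rewrite zE (ldiv_lift_field model drow_rep_differentiable zO) row_mxKl.
  by rewrite (laplacian_smooth_chart g ac qc smooth_rep) (fib_sqnorm_frame h y qc).
- by move=> z /tbundle_img.
- by rewrite /mkset zE.
- by move=> z zc; rewrite /comp (tbundle_invE zc) bproj_pt.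
- by move=> z zc; apply: differentiable_base; exact: rep_differentiable.
- by move=> z zc; exact: (drow_base model zc (rep_differentiable zc)).
- by rewrite zE; exact: (lift_field_differentiable model drow_rep_differentiable zO).
Qed.

Lemma laplacian_weighted_frame (U : total_space E -> R) (q : M) (y : 'rV[R]_k) :
  (forall (q : M) (v : fib E q), U (pt E v) = expR (- 2 * p1 (fmetric h v v)) * u q) ->
  cdom c q -> let r := fmetric h (frame T y q) (frame T y q) in
  laplacian G U (pt E (frame T y q)) =
  expR (- (4 * p1 r)) * laplacian g u q
  - 4 * expR (- (2 * (p1 r + p2 r)))
    * (2 * r * s1 r - 4 * r * q1 r * (q1 r + q2 r) + 2 * m%:R * r * q1 r ^+ 2
       + 2 * k%:R * r * q1 r * q2 r + k%:R * q1 r)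
    * u q.
Proof.
move=> UE qc r; have ve := tbundle_dom (frame T y q) qc.
have zE := tbundle_frame y qc.
have zO : cimg c (lsubmx (row_mx (cmap c q) y)) by rewrite row_mxKl; exists q.
rewrite [LHS](laplacian_chart (g := G) aC ve open_tbundle_base
  (w := weighted_lift (fib_gram T h) p1 w)
  (X := weighted_lift_grad (fib_gram T h) (conn_mx T D) p1 p2 q1 (gram g c) w)).
- rewrite zE (ldiv_weighted_field model rep_differentiable drow_rep_differentiable zO) row_mxKl.
  rewrite (laplacian_smooth_chart g ac qc smooth_rep) -(fib_sqnorm_frame h y qc) -/r.
  by rewrite /w /comp (cmapK (atlas_chart ac) qc).
- by move=> z /tbundle_img.
- by rewrite /mkset zE.
- move=> z zc; have [qd qE] := cimgP ac zc.
  by rewrite (tbundle_invE zc) UE (fib_sqnorm_frame h _ qd) qE hsubmxK.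
- by move=> z zc; exact: (weighted_lift_differentiable model rep_differentiable zc).
- by move=> z zc; exact: (drow_weighted_lift model rep_differentiable zc).
- rewrite zE.
  exact: (weighted_field_differentiable model rep_differentiable drow_rep_differentiable zO).
Qed.

End SmoothFunction.

End Lift.

Theorem proposition2p2 (R : realType) (m k : nat) (hk : (1 <= k)%N)
    (M : manifold R m) (g : riemannian_metric M)
    (E : vector_bundle k M) (h : fiber_metric E)
    (D : connection E) (hD : compatible D h) (K : connection_map D)
    (phi1 phi2 : R -> R) (hphi1 : smooth_Rplus phi1) (hphi2 : smooth_Rplus phi2)
    (G : riemannian_metric (total_space E))
    (hG : spherically_symmetric g h K phi1 phi2 G)
    (f : M -> R) (hf : smooth_fun [set: M] f) (p : M) (v : fib E p) :
  let r := fmetric h v v in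
  let d := @deriv_Rplus R in
  laplacian G (laplacian G (f \o bproj E)) (pt E v) =
    expR (- (4 * phi1 r)) * laplacian g (laplacian g f) p
    - 4 * expR (- (2 * (phi1 r + phi2 r)))
      * (2 * r * d (d phi1) r
         - 4 * r * d phi1 r * d (fun t => phi1 t + phi2 t) r
         + 2 * m%:R * r * d phi1 r ^+ 2
         + 2 * k%:R * r * d phi1 r * d phi2 r
         + k%:R * d phi1 r)
      * laplacian g f p.
Proof.
have hv q (v' : fib E q) : exists (T : trivialization E) (y : 'rV[R]_k),
    cdom (tchart T) q /\ v' = frame T y q.
  have [T Tq] := @exists_trivialization _ _ _ _ E q.
  by exists T, (tcoord T (pt E v')); rewrite frame_tcoord.
have r0 := fmetric_ge0 h v.
have lift q (v' : fib E q) : laplacian G (f \o bproj E) (pt E v') =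
    expR (- 2 * half_line_extension phi1 (fmetric h v' v')) * laplacian g f q.
  have [T [y [Tq ->]]] := hv q v'.
  exact: (laplacian_lift_frame hD hphi1 hphi2 hG hf y Tq).
move=> r d; have [T [y [Tp vE]]] := hv p v.
have := laplacian_weighted_frame hD hphi1 hphi2 hG (laplacian_smooth g hf) y lift Tp.
rewrite /= -vE -/r !half_line_extensionE// => ->.
by rewrite /d (deriv_RplusD (phi := phi1) (psi := phi2) r0 (hphi1 0%N r r0) (hphi2 0%N r r0)).
Qed.
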